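(* Let $n\geq 3$ and let $F$ be a (regular) spherically symmetric Finsler metric on a domain $\Omega\subseteq\mathbb{R}^n$. If $F$ is a Landsberg metric, then $F$ is Berwaldian.
   Context: A regular Finsler metric on $\Omega$ is a function $F(x,y)$ ($x\in\Omega$, $y\in T_x\Omega\cong\mathbb{R}^n$), positive and smooth for $y\neq0$, positively homogeneous of degree one in $y$, and such that $g_{ij}=\frac12\frac{\partial^2F^2}{\partial y^i\partial y^j}$ is positive definite for every $y\neq0$ (in all tangent directions, including the radial ones $y=kx$). It is called spherically symmetric if it is invariant under all rotations of $\mathbb{R}^n$; then $F=|y|\,\phi\left(|x|,\frac{\langle x,y\rangle}{|y|}\right)$ for a positive function $\phi$ of two variables, where $\langle\cdot,\cdot\rangle$ and $|\cdot|$ are the Euclidean inner product and norm. With $g^{ij}$ the inverse of $g_{ij}$, the geodesic spray coefficients are $G^i=\frac14 g^{il}\{(F^2)_{x^ky^l}y^k-(F^2)_{x^l}\}$ (summation convention). The Berwald curvature is $B^i_{\ jkl}=\frac{\partial^3G^i}{\partial y^j\partial y^k\partial y^l}$, and $F$ is Berwaldian if $B^i_{\ jkl}=0$. The Landsberg curvature is $L_{jkl}=-\frac12FF_{y^i}\frac{\partial^3G^i}{\partial y^j\partial y^k\partial y^l}$, and $F$ is a Landsberg metric if $L_{jkl}=0$. *)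

(* Defs.v *)
From HB Require Import structures.
From mathcomp Require Import all_boot all_order all_algebra.
From mathcomp Require Import all_classical all_reals all_analysis.

Set Implicit Arguments.
Unset Strict Implicit.
Unset Printing Implicit Defensive.

Import Order.TTheory GRing.Theory Num.Theory.
Import numFieldNormedType.Exports.

Local Open Scope classical_set_scope.
Local Open Scope ring_scope.

Section Smooth.
Context {R : realType} {V W : normedModType R}.

Definition iter_derive (vs : seq V) (f : V -> W) : V -> W :=
  foldr (fun v g => 'D_v g) f vs.

(* C^oo on an open set [A]: all iterated directional derivatives exist and are
   continuous on [A]. *)
Definition smooth_on (A : set V) (f : V -> W) : Prop :=
  forall (vs : seq V) (p : V), A p ->
    {for p, continuous (iter_derive vs f)} /\
    (forall v : V, derivable (iter_derive vs f) p v).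

End Smooth.

Definition domain {R : realType} {n : nat} (Omega : set 'rV[R]_n) : Prop :=
  [/\ Omega !=set0, open Omega & connected Omega].

Definition rotation {R : realType} {n : nat} (A : 'M[R]_n) : Prop :=
  A *m A^T = 1%:M /\ \det A = 1.

Section Finsler.
Context {R : realType} {n : nat}.

(* A point of the tangent bundle is a pair [p = (x, y)]: [p.1] is the base
   point and [p.2] the tangent vector. *)
Notation TM := ('rV[R]_n * 'rV[R]_n)%type.

Definition slit (Omega : set 'rV[R]_n) : set TM :=
  [set p | Omega p.1 /\ p.2 != 0].

Definition dx (i : 'I_n) (f : TM -> R) : TM -> R :=
  'D_((delta_mx 0 i, 0) : TM) f.

Definition dy (i : 'I_n) (f : TM -> R) : TM -> R :=
  'D_((0, delta_mx 0 i) : TM) f.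

Definition sq (F : TM -> R) : TM -> R := fun p => F p ^+ 2.

Definition fundamental_tensor (F : TM -> R) (p : TM) : 'M[R]_n :=
  \matrix_(i, j) (2^-1 * dy i (dy j (sq F)) p).

Definition positive_definite (g : 'M[R]_n) : Prop :=
  forall v : 'rV[R]_n, v != 0 -> 0 < (v *m g *m v^T) 0 0.

Definition regular_Finsler (Omega : set 'rV[R]_n) (F : TM -> R) : Prop :=
  [/\ smooth_on (slit Omega) F,
      forall p, slit Omega p -> 0 < F p,
      forall x y (c : R), Omega x -> 0 < c -> F (x, c *: y) = c * F (x, y)
    & forall p, slit Omega p -> positive_definite (fundamental_tensor F p)].

(* Vectors are rows, so the rotation by [A^T] is [x |-> x *m A].  When [Omega]
   is itself rotation invariant the hypothesis [Omega (x *m A)] is automatic;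
   in general [F] is compared wherever both sides make sense. *)
Definition spherically_symmetric (Omega : set 'rV[R]_n) (F : TM -> R) : Prop :=
  forall (A : 'M[R]_n) x y, rotation A -> Omega x -> Omega (x *m A) ->
    F (x *m A, y *m A) = F (x, y).

Definition spray (F : TM -> R) (i : 'I_n) : TM -> R := fun p =>
  4^-1 * \sum_(l < n) invmx (fundamental_tensor F p) i l *
    (\sum_(k < n) dy l (dx k (sq F)) p * p.2 0 k - dx l (sq F) p).

Definition Berwald_curvature (F : TM -> R) (i j k l : 'I_n) : TM -> R :=
  dy j (dy k (dy l (spray F i))).

Definition Landsberg_curvature (F : TM -> R) (j k l : 'I_n) : TM -> R :=
  fun p => - 2^-1 * F p *
    \sum_(i < n) dy i F p * dy j (dy k (dy l (spray F i))) p.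

Definition Berwaldian (Omega : set 'rV[R]_n) (F : TM -> R) : Prop :=
  forall i j k l p, slit Omega p -> Berwald_curvature F i j k l p = 0.

Definition Landsberg (Omega : set 'rV[R]_n) (F : TM -> R) : Prop :=
  forall j k l p, slit Omega p -> Landsberg_curvature F j k l p = 0.

End Finsler.

(* Main.v *)
From HB Require Import structures.
Require Import Defs.
From mathcomp Require Import all_boot all_order all_algebra.
From mathcomp Require Import all_classical all_reals all_analysis.
From mathcomp Require Import ring lra.

(** Write S = F^2 and let G be the spray.  The curvatures depend continuously
    on (x, y), so it suffices to treat y not orthogonal to x.  Fix such an x,
    a unit vector e1 = x / rho, and orthonormal e2, e3 orthogonal to e1, and
    restrict to y = a e1 + b e2 with a fixed and b > 0; a prime is d/db.
    Orthogonal maps fixing x act on G, so G = G1 e1 + G2 e2 there, and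
    rotations in the plane (e2, e3) give
      D3 D3 G1 = G1' / b  and  D3 D3 G2 = beta := (G2' - G2 / b) / b.
    Rotating x itself inside span(e1, e2), and using that the horizontal
    derivative of S vanishes, one gets
      (1)  S1 (G1' - b / rho) + S2 (G2' + a / rho) = 0,
    while the components (2,3,3) and (2,2,2) of the Landsberg tensor give
      (2)  S1 (G1' / b)' + S2 beta' = 0,   (3)  S1 G1''' + S2 G2''' = 0.
    With the Euler relations for S, (2), (2)' and (3) imply beta' S1' = 0; then
    (1)' gives beta beta' = 0.  So beta^2 is constant in b, and it tends to 0 at
    the radial direction b = 0, where F is smooth: this is the point at which
    regularity in all directions is used.  Hence beta = 0, then
    (G1' / b)' = 0, and G(x, .) is quadratic on the half-space a > 0. *)

Set Implicit Arguments.
Unset Strict Implicit.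
Unset Printing Implicit Defensive.

Import Order.TTheory GRing.Theory Num.Theory.
Import numFieldNormedType.Exports.

Local Open Scope classical_set_scope.
Local Open Scope ring_scope.

(** * Smooth functions *)

Section SmoothCalculus.
Context {R : realType} {V : normedModType R} {A : set V} (oA : open A).
Implicit Types f g : V -> R.

Lemma open_near p : A p -> \forall q \near p, A q.
Proof. by move=> Ap; exact: open_nbhs_nbhs. Qed.

Lemma eq_derivable_on f g p v :
  (forall q, A q -> f q = g q) -> A p -> derivable f p v -> derivable g p v.
Proof.
move=> fg Ap; apply: near_eq_derivable.
by near=> q; apply: fg; near: q; exact: open_near.
Unshelve. all: by end_near. Qed.

Lemma eq_derive_on f g p v :
  (forall q, A q -> f q = g q) -> A p -> 'D_v f p = 'D_v g p.
Proof.
move=> fg Ap; apply: near_eq_derive.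
by near=> q; apply: fg; near: q; exact: open_near.
Unshelve. all: by end_near. Qed.

Lemma eq_continuous_on f g p :
  (forall q, A q -> f q = g q) -> A p ->
  {for p, continuous f} -> {for p, continuous g}.
Proof.
move=> fg Ap; rewrite /prop_for /continuous_at -(fg _ Ap).
apply: cvg_trans; apply: near_eq_cvg.
by near=> q; rewrite fg//; near: q; exact: open_near.
Unshelve. all: by end_near. Qed.

(** Recursive in the order of differentiation, whereas [smooth_on] quantifies over whole words of
    directions: product and inverse rules can then be proved by induction on [k]. *)
Fixpoint Ck (k : nat) f : Prop :=
  (forall p, A p -> {for p, continuous f}) /\
  if k is k'.+1 then
    (forall p v, A p -> derivable f p v) /\ (forall v, Ck k' ('D_v f))
  else True.

Lemma CkS k f : Ck k.+1 f -> Ck k f.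
Proof.
elim: k f => [|k IH] f /= [cf [df Df]]; first by split.
by split=> //; split=> // v; apply: IH; exact: Df.
Qed.

Lemma eq_Ck k f g : (forall q, A q -> f q = g q) -> Ck k f -> Ck k g.
Proof.
elim: k f g => [|k IH] f g fg /= [cf].
  by move=> _; split=> // p Ap; exact: eq_continuous_on (cf _ Ap).
move=> [df Df]; split; first by move=> p Ap; exact: eq_continuous_on (cf _ Ap).
split; first by move=> p v Ap; exact: eq_derivable_on (df _ _ Ap).
by move=> v; apply: IH (Df v) => q Aq; exact: eq_derive_on.
Qed.

Lemma CkD k f g : Ck k f -> Ck k g -> Ck k (f + g).
Proof.
elim: k f g => [|k IH] f g /= [cf fk] [cg gk].
  by split=> // p Ap; apply: continuousD; [exact: cf|exact: cg].
move: fk gk => [df Df] [dg Dg]; split.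
  by move=> p Ap; apply: continuousD; [exact: cf|exact: cg].
split; first by move=> p v Ap; apply: derivableD; [exact: df|exact: dg].
move=> v; apply: eq_Ck (IH _ _ (Df v) (Dg v)) => q Aq.
by rewrite deriveD//; [exact: df|exact: dg].
Qed.

Lemma CkM k f g : Ck k f -> Ck k g -> Ck k (f * g).
Proof.
elim: k f g => [|k IH] f g.
  move=> /= [cf fk] [cg gk].
  by split=> // p Ap; apply: continuousM; [exact: cf|exact: cg].
move=> fk1 gk1; have fk := CkS fk1; have gk := CkS gk1.
move: fk1 gk1 => /= [cf [df Df]] [cg [dg Dg]]; split.
  by move=> p Ap; apply: continuousM; [exact: cf|exact: cg].
split; first by move=> p v Ap; apply: derivableM; [exact: df|exact: dg].
move=> v; apply: eq_Ck (CkD (IH _ _ fk (Dg v)) (IH _ _ gk (Df v))) => q Aq.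
by rewrite deriveM//; [exact: df|exact: dg].
Qed.

Lemma Ck_cst k (c : R) : Ck k (cst c).
Proof.
elim: k c => [|k IH] c /=; first by split=> // p _; exact: cst_continuous.
split; first by move=> p _; exact: cst_continuous.
split=> [p v _|v]; first exact: derivable_cst.
by apply: eq_Ck (IH 0) => q _; rewrite derive_cst.
Qed.

(** The derivative of [1/f] is [-(1/f)^2] times that of [f], and [1/f] already has order [k] by
    induction. *)
Lemma CkV k f : (forall p, A p -> f p != 0) -> Ck k f ->
  Ck k (fun p => (f p)^-1).
Proof.
move=> f0; elim: k f f0 => [|k IH] f f0.
  by move=> /= [cf fk]; split=> // p Ap; apply: continuousV; [exact: f0|exact: cf].
move=> fk1; have fk := CkS fk1; move: fk1 => /= [cf [df Df]]; split.
  by move=> p Ap; apply: continuousV; [exact: f0|exact: cf].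
split; first by move=> p v Ap; apply: derivableV; [exact: f0|exact: df].
have Vk := IH _ f0 fk.
move=> v; apply: eq_Ck (CkM (CkM (Ck_cst k (-1)) (CkM Vk Vk)) (Df v)) => q Aq.
rewrite deriveV//; [|exact: f0|exact: df].
by rewrite !fctE /cst -exprVn expr2 mulN1r.
Qed.

Lemma smooth_derive v f : smooth_on A f -> smooth_on A ('D_v f).
Proof.
by move=> sf vs p Ap; have := sf (rcons vs v) p Ap; rewrite /iter_derive foldr_rcons.
Qed.

Lemma smooth_CkP f : smooth_on A f <-> (forall k, Ck k f).
Proof.
split=> [sf k|Cf vs].
  elim: k f sf => [|k IH] f sf /=.
    by split=> // p Ap; have [] := sf [::] p Ap.
  split; first by move=> p Ap; have [] := sf [::] p Ap.
  split; first by move=> p v Ap; have [_] := sf [::] p Ap; exact.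
  by move=> v; apply/IH/smooth_derive.
(* [foldr] applies the last direction of the word first, so words are peeled from the right. *)
elim/last_ind: vs f Cf => [|vs v IH] f Cf p Ap.
  by have [cf [df _]] := Cf 1%N; split; [exact: cf|move=> v; exact: df].
rewrite /iter_derive foldr_rcons; apply: IH => // k.
by have [_ [_]] := Cf k.+1; exact.
Qed.

Lemma smooth_continuous f p : smooth_on A f -> A p -> {for p, continuous f}.
Proof. by move=> sf Ap; have [] := sf [::] p Ap. Qed.

Lemma smooth_derivable f p v : smooth_on A f -> A p -> derivable f p v.
Proof. by move=> sf Ap; have [_] := sf [::] p Ap; exact. Qed.

Lemma eq_smooth f g :
  (forall q, A q -> f q = g q) -> smooth_on A f -> smooth_on A g.
Proof.
by move=> fg /smooth_CkP sf; apply/smooth_CkP => k; exact: eq_Ck (sf k).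
Qed.

Lemma smoothD f g : smooth_on A f -> smooth_on A g -> smooth_on A (fun p => f p + g p).
Proof.
move=> /smooth_CkP sf /smooth_CkP sg; apply/smooth_CkP => k.
exact: CkD (sf k) (sg k).
Qed.

Lemma smoothM f g : smooth_on A f -> smooth_on A g -> smooth_on A (fun p => f p * g p).
Proof.
move=> /smooth_CkP sf /smooth_CkP sg; apply/smooth_CkP => k.
exact: CkM (sf k) (sg k).
Qed.

Lemma smooth_cst (c : R) : smooth_on A (cst c).
Proof. by apply/smooth_CkP => k; exact: Ck_cst. Qed.

Lemma smoothV f : (forall p, A p -> f p != 0) -> smooth_on A f ->
  smooth_on A (fun p => (f p)^-1).
Proof.
by move=> f0 /smooth_CkP sf; apply/smooth_CkP => k; exact: CkV (sf k).
Qed.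

Lemma smoothZ (c : R) f : smooth_on A f -> smooth_on A (fun p => c * f p).
Proof. by move=> sf; have := smoothM (smooth_cst c) sf. Qed.

Lemma smoothB f g :
  smooth_on A f -> smooth_on A g -> smooth_on A (fun p => f p - g p).
Proof.
move=> sf sg; apply: eq_smooth (smoothD sf (smoothZ (-1) sg)) => q _.
by rewrite mulN1r.
Qed.

Lemma smooth_sum (I : Type) (r : seq I) (P : pred I) (h : I -> V -> R) :
  (forall i, smooth_on A (h i)) ->
  smooth_on A (fun p => \sum_(i <- r | P i) h i p).
Proof.
move=> sh; elim: r => [|i r IH].
  by apply: eq_smooth (smooth_cst 0) => q _; rewrite big_nil.
case Pi : (P i); last by apply: eq_smooth IH => q _; rewrite big_cons Pi.
by apply: eq_smooth (smoothD (sh i) IH) => q _; rewrite big_cons Pi.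
Qed.

Lemma smooth_prod (I : Type) (r : seq I) (P : pred I) (h : I -> V -> R) :
  (forall i, smooth_on A (h i)) ->
  smooth_on A (fun p => \prod_(i <- r | P i) h i p).
Proof.
move=> sh; elim: r => [|i r IH].
  by apply: eq_smooth (smooth_cst 1) => q _; rewrite big_nil.
case Pi : (P i); last by apply: eq_smooth IH => q _; rewrite big_cons Pi.
by apply: eq_smooth (smoothM (sh i) IH) => q _; rewrite big_cons Pi.
Qed.

Lemma derive_sumE (I : Type) (r : seq I) (h : I -> V -> R) p v :
  (forall i, smooth_on A (h i)) -> A p ->
  'D_v (fun q => \sum_(i <- r) h i q) p = \sum_(i <- r) 'D_v (h i) p.
Proof.
move=> sh Ap; elim: r => [|i r IH].
  rewrite (_ : (fun q => _) = cst 0) ?derive_cst ?big_nil//.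
  by apply/funext => q; rewrite big_nil.
rewrite big_cons -IH -deriveD; last 2 first.
- exact: smooth_derivable (sh i) Ap.
- exact: smooth_derivable (smooth_sum r xpredT sh) Ap.
rewrite (_ : (fun q => _) = h i + (fun q => \sum_(j <- r) h j q))//.
by apply/funext => q; rewrite big_cons.
Qed.

Lemma deriveZE (c : R) f p v : smooth_on A f -> A p ->
  'D_v (fun q => c * f q) p = c * 'D_v f p.
Proof.
move=> sf Ap; rewrite (_ : (fun q => _) = c \*o f)//.
by rewrite deriveMl//; exact: smooth_derivable sf Ap.
Qed.

Lemma deriveME f g p v : smooth_on A f -> smooth_on A g -> A p ->
  'D_v (fun q => f q * g q) p = f p * 'D_v g p + g p * 'D_v f p.
Proof.
move=> sf sg Ap; rewrite (_ : (fun q => _) = f * g)//.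
by rewrite deriveM//; [exact: smooth_derivable sf Ap|exact: smooth_derivable sg Ap].
Qed.

Lemma deriveBE f g p v : smooth_on A f -> smooth_on A g -> A p ->
  'D_v (fun q => f q - g q) p = 'D_v f p - 'D_v g p.
Proof.
move=> sf sg Ap; rewrite (_ : (fun q => _) = f - g)//.
by rewrite deriveB//; [exact: smooth_derivable sf Ap|exact: smooth_derivable sg Ap].
Qed.

Lemma derive_linear (l : V -> R) p v :
  (forall (c : R) u v, l (c *: u + v) = c * l u + l v) -> 'D_v l p = l v.
Proof.
move=> ll; apply: cvg_lim => //; apply: cvg_near_cst; near=> h.
rewrite /= ll addrK /GRing.scale/= mulKf//.
by near: h; exact: nbhs_dnbhs_neq.
Unshelve. all: by end_near. Qed.

Lemma smooth_linear (l : V -> R) : continuous l ->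
  (forall (c : R) u v, l (c *: u + v) = c * l u + l v) -> smooth_on A l.
Proof.
move=> cl ll; apply/smooth_CkP => -[|k] /=; split=> //; first by move=> p _; exact: cl.
  by move=> p _; exact: cl.
split=> [p v _|v].
  apply/cvg_ex; exists (l v); apply: cvg_near_cst; near=> h.
  rewrite /= ll addrK /GRing.scale/= mulKf//.
  by near: h; exact: nbhs_dnbhs_neq.
by apply: eq_Ck (Ck_cst k (l v)) => q _; rewrite derive_linear.
Unshelve. all: by end_near. Qed.

End SmoothCalculus.

(** * Directional derivatives along curves *)

Section DirectionalCalculus.
Context {R : realType} {V : normedModType R}.
Implicit Types f : V -> R.

Lemma is_derive_line f p v (s : R) : derivable f (p + s *: v) v ->
  is_derive s 1 (fun t : R => f (p + t *: v)) ('D_v f (p + s *: v)).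
Proof.
move=> df.
have E : (fun h : R => h^-1 *: (((fun t : R => f (p + t *: v)) \o shift s) (h *: 1)
    - f (p + s *: v))) =
  (fun h : R => h^-1 *: ((f \o shift (p + s *: v)) (h *: v) - f (p + s *: v))).
  apply/funext => h /=; congr (_ *: (f _ - _)).
  by rewrite [h *: 1]mulr1 scalerDl addrCA.
by split; rewrite /derivable /derive E.
Qed.

Lemma line_MVT f p v (h : R) :
  (forall s : R, `|s| <= `|h| -> derivable f (p + s *: v) v) ->
  exists2 s : R, `|s| <= `|h| & f (p + h *: v) - f p = h * 'D_v f (p + s *: v).
Proof.
move=> df; pose g (t : R) := f (p + t *: v).
have dg (s : R) : `|s| <= `|h| -> is_derive s 1 g ('D_v f (p + s *: v)).
  by move=> sh; exact: is_derive_line (df _ sh).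
have cg (a b : R) : `|a| <= `|h| -> `|b| <= `|h| ->
    {within `[a, b], continuous g}.
  move=> ah bh; apply: derivable_within_continuous => x; rewrite in_itv/= => /andP[ax xb].
  have /dg[] // : `|x| <= `|h|.
  by move: ah bh; rewrite !ler_norml => /andP[? ?] /andP[? ?]; apply/andP; split; lra.
have p0 : f p = g 0 by rewrite /g scale0r addr0.
rewrite p0 -/(g h); case: (leP 0 h) => h0.
  have [|//||s sh E] := @MVT_segment R g (fun s => 'D_v f (p + s *: v)) 0 h.
  - exact: h0.
  - move=> x; rewrite in_itv/= => /andP[x0 xh]; apply: dg.
    by rewrite !ger0_norm ?ltW//; lra.
  - by apply: cg; rewrite ?normr0.
  exists s; last by rewrite E subr0 mulrC.
  by move: sh; rewrite in_itv/= => /andP[s0 sh]; rewrite !ger0_norm.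
have [|//||s sh E] := @MVT_segment R g (fun s => 'D_v f (p + s *: v)) h 0.
- exact: ltW.
- move=> x; rewrite in_itv/= => /andP[xh x0]; apply: dg.
  by rewrite !ler0_norm ?ltW// ; lra.
- by apply: cg; rewrite ?normr0.
exists s; last by rewrite -opprB E sub0r mulrN opprK mulrC.
by move: sh; rewrite in_itv/= => /andP[s0 sh]; rewrite (ler0_norm sh) (ler0_norm (ltW h0)) lerN2.
Qed.

Context {A : set V} (oA : open A).

(** Mean value theorem along [u], then along [v], with continuity of both derivatives. This
    first-order estimate takes the place of total differentiability, since [smooth_on] speaks of
    directional derivatives only. *)
Lemma smooth_increment f p u v (e : R) : smooth_on A f -> A p -> 0 < e ->
  exists2 d : R, 0 < d & forall s t : R, `|s| <= d -> `|t| <= d ->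
   `|f (p + s *: u + t *: v) - f p - s * 'D_u f p - t * 'D_v f p| <=
   e * (`|s| + `|t|).
Proof.
move=> sf Ap e0.
have cu := smooth_continuous (smooth_derive u sf) Ap.
have cv := smooth_continuous (smooth_derive v sf) Ap.
have {cu}/cvgrPdist_le/(_ e e0) cu := cu.
have {cv}/cvgrPdist_le/(_ e e0) cv := cv.
have : \forall q \near p, [/\ A q, `|'D_u f p - 'D_u f q| <= e
    & `|'D_v f p - 'D_v f q| <= e].
  by move: cu cv; apply: filterS3 (open_near oA Ap) => q.
rewrite -nbhs_nearE => /nbhs_ballP[r /= r0 rP].
(* The radius [d] keeps every displaced point within the ball of radius [r]; the summand 1 makes [M]
   positive even when [u = v = 0]. *)
pose M := 1 + `|u| + `|v|.
have M0 : 0 < M by rewrite /M -addrA ltr_pwDl// addr_ge0.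
pose d := r / (2 * M).
have d0 : 0 < d by rewrite divr_gt0// mulr_gt0.
have dM : d * (`|u| + `|v|) < r.
  rewrite /d mulrAC ltr_pdivrMr ?mulr_gt0// ltr_pM2l// /M.
  have := normr_ge0 u; have := normr_ge0 v; lra.
exists d => // s t sd td.
have close (s' t' : R) : `|s'| <= d -> `|t'| <= d ->
    [/\ A (p + s' *: u + t' *: v),
      `|'D_u f p - 'D_u f (p + s' *: u + t' *: v)| <= e
    & `|'D_v f p - 'D_v f (p + s' *: u + t' *: v)| <= e].
  move=> s'd t'd; apply: rP.
  rewrite -ball_normE /ball_/= -addrA opprD addNKr normrN.
  apply: le_lt_trans (ler_normD _ _) _; rewrite !normrZ.
  apply: le_lt_trans dM; rewrite mulrDr.
  by apply: lerD; exact: ler_wpM2r.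
have [|s' s'h Es] := @line_MVT f p u s.
  move=> s' s's; have [||] := close s' 0; [exact: le_trans sd|by rewrite normr0 ltW|].
  rewrite scale0r addr0 => As' _ _; exact: smooth_derivable sf As'.
have [|t' t'h Et] := @line_MVT f (p + s *: u) v t.
  move=> t' t't; have [|As' _ _] := close s t' sd; first exact: le_trans td.
  exact: smooth_derivable sf As'.
have [|_ _ Hv] := close s t' sd; first exact: le_trans td.
have [||_ Hu _] := close s' 0; [exact: le_trans sd|by rewrite normr0 ltW|].
move: Hu; rewrite scale0r addr0 => Hu.
have -> : f (p + s *: u + t *: v) - f p - s * 'D_u f p - t * 'D_v f p =
    - (s * ('D_u f p - 'D_u f (p + s' *: u))
     + t * ('D_v f p - 'D_v f (p + s *: u + t' *: v))).
  rewrite !mulrBr -Es -Et; ring.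
rewrite normrN [e * _]mulrDr; apply: le_trans (ler_normD _ _) _.
by rewrite !normrM ![e * _]mulrC; apply: lerD; exact: ler_wpM2l.
Unshelve. all: by end_near. Qed.

(** Chain rule for curves in a two-dimensional slice; it serves both linearity in the direction and
    the rotations below. *)
Lemma is_derive_curve f p u v (s t : R -> R) (ds dt : R) :
  smooth_on A f -> A p -> s 0 = 0 -> t 0 = 0 ->
  is_derive (0 : R) 1 s ds -> is_derive (0 : R) 1 t dt ->
  is_derive (0 : R) 1 (fun x => f (p + s x *: u + t x *: v))
    (ds * 'D_u f p + dt * 'D_v f p).
Proof.
move=> sf Ap s0 t0 [Ds Es] [Dt Et].
have cvgq (g : R -> R) dg : g 0 = 0 -> derivable g 0 1 -> 'D_1 g 0 = dg ->
    (fun h : R => h^-1 * g h) @ 0^' --> dg.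
  move=> g0 + <-; rewrite /derivable /derive.
  rewrite (_ : (fun h : R => _) = (fun h : R => h^-1 * g h))//.
  by apply/funext => h; rewrite /= g0 subr0 addr0 /GRing.scale/= mulr1.
have qs := cvgq _ _ s0 Ds Es; have qt := cvgq _ _ t0 Dt Et.
have cvg0 (g : R -> R) : g 0 = 0 -> derivable g 0 1 -> g @ (0 : R)^' --> (0 : R).
  move=> g0 /derivable1_diffP/differentiable_continuous/continuous_withinNx.
  by rewrite g0.
have cs := cvg0 _ s0 Ds; have ct := cvg0 _ t0 Dt.
pose q (h : R) := h^-1 *: (f (p + s h *: u + t h *: v) - f p).
suff Q : q @ 0^' --> ds * 'D_u f p + dt * 'D_v f p.
  have E : (fun h : R => h^-1 *: (((fun x => f (p + s x *: u + t x *: v)) \o shift 0)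
    (h *: 1) - f (p + s 0 *: u + t 0 *: v))) = q.
    apply/funext => h; rewrite /q /= addr0 s0 t0 !scale0r !addr0.
    by rewrite [h *: 1]mulr1.
  split; rewrite /derivable /derive E; last exact: cvg_lim Q.
  by apply/cvg_ex; eexists; exact: Q.
(* [r] is the linear part of the quotient [q]; the difference [q - r] is the error controlled by
   [smooth_increment]. *)
pose r (h : R) := h^-1 * s h * 'D_u f p + h^-1 * t h * 'D_v f p.
have rL : r @ 0^' --> ds * 'D_u f p + dt * 'D_v f p.
  by apply: cvgD; (apply: cvgM; [|exact: cvg_cst]).
have -> : q = r + (q - r) by apply/funext => h; rewrite !fctE addrC subrK.
rewrite -[X in _ --> X]addr0; apply: cvgD => //.
apply/cvgrPdist_le => e e0.
(* Near 0 the quotients [s h / h] and [t h / h] are within 1 of [ds] and [dt], so their absolute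
   values add up to at most [M]. *)
pose M := `|ds| + `|dt| + 2.
have M0 : 0 < M by rewrite /M ltr_wpDl// addr_ge0.
have eM0 : 0 < e / M by rewrite divr_gt0.
have [d d0 dP] := smooth_increment u v sf Ap eM0.
near=> h.
have h0 : h != 0 by near: h; exact: nbhs_dnbhs_neq.
have sd : `|s h| <= d.
  near: h; move/cvgrPdist_le : cs => /(_ _ d0).
  by apply: filterS => h; rewrite sub0r normrN.
have td : `|t h| <= d.
  near: h; move/cvgrPdist_le : ct => /(_ _ d0).
  by apply: filterS => h; rewrite sub0r normrN.
have s1 : `|h^-1 * s h| <= `|ds| + 1.
  near: h; move/cvgrPdist_le : qs => /(_ _ ltr01).
  apply: filterS => h; rewrite distrC => H.
  by rewrite -[X in `|X|](subrK ds) addrC (le_trans (ler_normD _ _))// lerD2l.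
have t1 : `|h^-1 * t h| <= `|dt| + 1.
  near: h; move/cvgrPdist_le : qt => /(_ _ ltr01).
  apply: filterS => h; rewrite distrC => H.
  by rewrite -[X in `|X|](subrK dt) addrC (le_trans (ler_normD _ _))// lerD2l.
rewrite sub0r normrN !fctE /q /r /GRing.scale/=.
rewrite (_ : _ - _ = h^-1 * (f (p + s h *: u + t h *: v) - f p -
   s h * 'D_u f p - t h * 'D_v f p)); last by ring.
rewrite normrM; apply: le_trans (ler_wpM2l (normr_ge0 _) (dP _ _ sd td)) _.
rewrite mulrCA mulrDr -!normrM.
apply: (@le_trans _ _ (e / M * M)); last by rewrite divfK// gt_eqF.
by apply: ler_wpM2l; [exact: ltW|rewrite /M; lra].
Unshelve. all: by end_near. Qed.

(** The line with direction [a u + b v] is also a curve in the slice spanned by [u] and [v]; its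
    derivative is computed in both ways. *)
Lemma derive_comb f p u v (a b : R) : smooth_on A f -> A p ->
  'D_(a *: u + b *: v) f p = a * 'D_u f p + b * 'D_v f p.
Proof.
move=> sf Ap.
have dl (c : R) : is_derive (0 : R) 1 (fun x : R => x * c) c.
  apply: is_derive_eq => //.
  rewrite /GRing.scale/=; ring.
have := @is_derive_curve f p u v (fun x => x * a) (fun x => x * b) a b sf Ap
  (mul0r _) (mul0r _) (dl a) (dl b).
have -> : (fun x : R => f (p + (x * a) *: u + (x * b) *: v)) =
    (fun x : R => f (p + x *: (a *: u + b *: v))).
  by apply/funext => x; rewrite scalerDr !scalerA addrA.
move=> [_ <-].
have [|_] := @is_derive_line f p (a *: u + b *: v) 0; last first.
  by rewrite scale0r addr0.
by rewrite scale0r addr0; exact: smooth_derivable sf Ap.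
Qed.

Lemma derive_dirD f p u v : smooth_on A f -> A p ->
  'D_(u + v) f p = 'D_u f p + 'D_v f p.
Proof.
by move=> sf Ap; have := derive_comb u v 1 1 sf Ap; rewrite !scale1r !mul1r.
Qed.

Lemma derive_dirZ f p u (a : R) : smooth_on A f -> A p ->
  'D_(a *: u) f p = a * 'D_u f p.
Proof.
by move=> sf Ap; have := derive_comb u 0 a 0 sf Ap; rewrite scaler0 addr0 mul0r addr0.
Qed.

Lemma derive_dir_sum f p (I : Type) (r : seq I) (c : I -> R) (w : I -> V) :
  smooth_on A f -> A p ->
  'D_(\sum_(i <- r) c i *: w i) f p = \sum_(i <- r) c i * 'D_(w i) f p.
Proof.
move=> sf Ap; elim: r => [|i r IH]; first by rewrite !big_nil derive0.
by rewrite !big_cons derive_dirD// derive_dirZ// IH.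
Qed.

End DirectionalCalculus.

(** * Euclidean isometries *)

Section Dot.
Context {R : realType} {n : nat}.
Implicit Types u v w x y : 'rV[R]_n.

Definition dot u v : R := (u *m v^T) 0 0.

Lemma dotE u v : dot u v = \sum_i u 0 i * v 0 i.
Proof. by rewrite /dot mxE; apply: eq_bigr => i _; rewrite mxE. Qed.

Lemma dotC u v : dot u v = dot v u.
Proof. by rewrite !dotE; apply: eq_bigr => i _; rewrite mulrC. Qed.

Lemma dotDl u v w : dot (u + v) w = dot u w + dot v w.
Proof. by rewrite /dot mulmxDl mxE. Qed.

Lemma dotDr u v w : dot w (u + v) = dot w u + dot w v.
Proof. by rewrite dotC dotDl !(dotC w). Qed.

Lemma dotZl (c : R) u w : dot (c *: u) w = c * dot u w.
Proof. by rewrite /dot -scalemxAl mxE. Qed.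

Lemma dotZr (c : R) u w : dot w (c *: u) = c * dot w u.
Proof. by rewrite dotC dotZl (dotC w). Qed.

Lemma dotNl u w : dot (- u) w = - dot u w.
Proof. by rewrite -scaleN1r dotZl mulN1r. Qed.

Lemma dotNr u w : dot w (- u) = - dot w u.
Proof. by rewrite dotC dotNl (dotC w). Qed.

Lemma dot0l w : dot 0 w = 0.
Proof. by rewrite /dot mul0mx mxE. Qed.

Definition dot_lin := (dotDl, dotDr, dotNl, dotNr, dotZl, dotZr).

Lemma dot_gt0 u : u != 0 -> 0 < dot u u.
Proof.
move=> u0; rewrite dotE lt_neqAle eq_sym sumr_ge0 ?andbT; last first.
  by move=> i _; rewrite -expr2 sqr_ge0.
apply: contra_neq u0 => /psumr_eq0P E; apply/rowP => i; rewrite mxE.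
have /eqP := E (fun i _ => sqr_ge0 (u 0 i)) i isT.
by rewrite mulf_eq0 orbb => /eqP.
Qed.

Lemma dot_eq0 u : dot u u = 0 -> u = 0.
Proof. by move=> E; apply/eqP; apply: contraT => /dot_gt0; rewrite E ltxx. Qed.

Lemma dot_delta u i : dot u (delta_mx 0 i) = u 0 i.
Proof. by rewrite /dot trmx_delta -colE mxE. Qed.

(** The matrix with columns [u] and [v] has rank at most 2, less than [n], so some nonzero row is in
    its left kernel; normalise it. *)
Lemma unit_orthogonal u v : (3 <= n)%N ->
  exists w, [/\ dot w w = 1, dot w u = 0 & dot w v = 0].
Proof.
move=> n3; pose M := row_mx u^T v^T.
have /rowV0Pn[w] : kermx M != 0.
  rewrite -mxrank_eq0 mxrank_ker -lt0n subn_gt0.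
  by apply: leq_ltn_trans (rank_leq_col M) _.
rewrite sub_kermx mul_mx_row => /eqP E w0.
have [E1 E2] : w *m u^T = 0 /\ w *m v^T = 0.
  by apply/eq_row_mx; rewrite row_mx0.
have d0 := dot_gt0 w0; have s0 : 0 < Num.sqrt (dot w w) by rewrite sqrtr_gt0.
exists ((Num.sqrt (dot w w))^-1 *: w); rewrite !dot_lin.
have wu : dot w u = 0 by rewrite /dot E1 mxE.
have wv : dot w v = 0 by rewrite /dot E2 mxE.
rewrite wu wv !mulr0; split=> //.
by rewrite mulrA -invfM -expr2 sqr_sqrtr ?ltW// mulVf// gt_eqF.
Qed.

Definition orthogonal_mx (T : 'M[R]_n) := T *m T^T = 1%:M.

Lemma orthogonal_mxP (T : 'M[R]_n) :
  (forall u v, dot (u *m T) (v *m T) = dot u v) -> orthogonal_mx T.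
Proof.
move=> dT; apply/matrixP => i j.
have := dT (delta_mx 0 i) (delta_mx 0 j); rewrite dot_delta /dot trmx_mul mulmxA.
rewrite -(mulmxA (delta_mx 0 i)) trmx_delta -rowE -colE !mxE eqxx /=.
by rewrite [in RHS]eq_sym => <-; apply: eq_bigr => k _; rewrite !mxE.
Qed.

Lemma mulmx_dot (x u v : 'rV[R]_n) : x *m (u^T *m v) = dot x u *: v.
Proof.
rewrite mulmxA; apply/rowP => i; rewrite !mxE big_ord1; congr (_ * _).
Qed.

Definition reflection v : 'M[R]_n := 1%:M - 2 *: (v^T *m v).

Lemma mul_reflection x v : x *m reflection v = x - (2 * dot x v) *: v.
Proof. by rewrite /reflection mulmxBr mulmx1 -scalemxAr mulmx_dot scalerA. Qed.

Lemma reflection_orthogonal v : dot v v = 1 -> orthogonal_mx (reflection v).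
Proof.
move=> v1; apply: orthogonal_mxP => x y.
by rewrite !mul_reflection !dot_lin v1 (dotC v y); ring.
Qed.

(** Eliminating either diagonal block of [P] computes [\det P] from a Schur complement:
    [reflection v] on one side, the scalar [1 - 2 (v . v) = -1] on the other. *)
Lemma det_reflection v : dot v v = 1 -> \det (reflection v) = -1.
Proof.
move=> v1; have vv : v *m v^T = 1%:M.
  by apply/matrixP => i j; rewrite !ord1 -/(dot v v) v1 !mxE.
pose P : 'M[R]_(1 + n) := block_mx 1%:M v (2 *: v^T) 1%:M.
have E1 : block_mx 1%:M 0 (- (2 *: v^T)) 1%:M *m P =
    block_mx 1%:M v 0 (reflection v).
  rewrite mulmx_block !mul1mx !mulmx1 !mul0mx !addr0 addNr /reflection.
  by rewrite mulNmx -scalemxAl addrC.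
have E2 : block_mx 1%:M (- v) 0 1%:M *m P =
    block_mx (- 1%:M) 0 (2 *: v^T) 1%:M.
  rewrite mulmx_block !mul1mx !mulmx1 !mul0mx !add0r addrN.
  rewrite mulNmx -scalemxAr vv; congr (block_mx _ _ _ _).
  by apply/matrixP => i j; rewrite !ord1 !mxE; ring.
have := congr1 determinant E1; rewrite det_mulmx det_lblock det_ublock !det1.
rewrite !mul1r => <-.
have := congr1 determinant E2; rewrite det_mulmx det_lblock det_ublock !det1.
by rewrite !mul1r mulr1 -scaleN1r detZ det1 mulr1 expr1.
Qed.

(** Written as the identity plus [cos t - 1] and [sin t] times fixed matrices, so that orbits are
    curves of the shape treated by [is_derive_curve]. *)
Definition plane_rotation u v (t : R) : 'M[R]_n :=
  1%:M + (cos t - 1) *: (u^T *m u + v^T *m v) + sin t *: (u^T *m v - v^T *m u).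

Lemma mul_plane_rotation x u v t : x *m plane_rotation u v t =
  x + (cos t - 1) *: (dot x u *: u + dot x v *: v)
    + sin t *: (dot x u *: v - dot x v *: u).
Proof.
by rewrite /plane_rotation !mulmxDr mulmx1 -!scalemxAr mulmxBr mulmxDr !mulmx_dot.
Qed.

Lemma plane_rotation_orthogonal u v t : dot u u = 1 -> dot v v = 1 -> dot u v = 0 ->
  orthogonal_mx (plane_rotation u v t).
Proof.
move=> u1 v1 uv; apply: orthogonal_mxP => x y.
have vu : dot v u = 0 by rewrite dotC.
rewrite !mul_plane_rotation !dot_lin u1 v1 uv vu (dotC u y) (dotC v y).
have E : sin t ^+ 2 = 1 - cos t ^+ 2.
  by apply/eqP; rewrite eq_sym subr_eq addrC eq_sym cos2Dsin2.
transitivity (dot x y + (2 * (cos t - 1) + (cos t - 1) ^+ 2 + sin t ^+ 2) *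
   (dot x u * dot y u + dot x v * dot y v)); first by ring.
by rewrite E; ring.
Qed.

Lemma plane_rotation0 u v : plane_rotation u v 0 = 1%:M.
Proof. by rewrite /plane_rotation cos0 sin0 subrr !scale0r !addr0. Qed.

(* As [n >= 3], a reflection fixing both [x *m T] and [y *m T] corrects the sign
   of the determinant. *)
Lemma orthogonal_invariant (F : 'rV[R]_n * 'rV[R]_n -> R) (Omega : set 'rV[R]_n) T x y :
  (3 <= n)%N -> spherically_symmetric Omega F -> orthogonal_mx T ->
  Omega x -> Omega (x *m T) -> F (x *m T, y *m T) = F (x, y).
Proof.
move=> n3 sF oT Ox OxT.
have : \det T ^+ 2 == 1 by rewrite expr2 -{2}det_tr -det_mulmx oT det1.
rewrite sqrf_eq1 => /orP[/eqP dT|/eqP dT]; first exact: sF.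
have [w [w1 wx wy]] := unit_orthogonal (x *m T) (y *m T) n3.
have xE : x *m T = x *m (T *m reflection w).
  by rewrite mulmxA mul_reflection [dot (_ *m _) _]dotC wx mulr0 scale0r subr0.
have yE : y *m T = y *m (T *m reflection w).
  by rewrite mulmxA mul_reflection [dot (_ *m _) _]dotC wy mulr0 scale0r subr0.
rewrite xE yE; apply: sF; rewrite -?xE//; split.
  rewrite trmx_mul mulmxA -(mulmxA T) reflection_orthogonal// mulmx1; exact: oT.
by rewrite det_mulmx det_reflection// dT mulrNN mulr1.
Qed.

End Dot.

(** * Derivatives on the tangent bundle *)

Lemma derive_comp_linear {R : realType} {V W : normedModType R} (L : V -> W) (f : W -> R) p w :
  (forall (c : R) u v, L (c *: u + v) = c *: L u + L v) ->
  'D_(L w) f (L p) = 'D_w (f \o L) p.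
Proof.
move=> lL; rewrite /derive; congr (lim _).
by rewrite (_ : (fun h : R => _) = (fun h : R =>
   h^-1 *: (((f \o L) \o shift p) (h *: w) - (f \o L) p)))//;
   apply/funext => h /=; rewrite lL.
Qed.

(* [Dy] and [Dx] are locked: failed unifications would otherwise unfold limits. *)
HB.lock Definition Dy {R : realType} {n : nat} (v : 'rV[R]_n)
    (f : 'rV[R]_n * 'rV[R]_n -> R) : 'rV[R]_n * 'rV[R]_n -> R :=
  'D_((0, v) : 'rV[R]_n * 'rV[R]_n) f.

HB.lock Definition Dx {R : realType} {n : nat} (v : 'rV[R]_n)
    (f : 'rV[R]_n * 'rV[R]_n -> R) : 'rV[R]_n * 'rV[R]_n -> R :=
  'D_((v, 0) : 'rV[R]_n * 'rV[R]_n) f.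

Section TangentBundle.
Context {R : realType} {n : nat}.
Notation TM := ('rV[R]_n * 'rV[R]_n)%type.
Implicit Types (f h : TM -> R) (u v w : 'rV[R]_n) (p q : TM).

Lemma DyE v f p : Dy v f p = 'D_((0, v) : TM) f p.
Proof. by rewrite Dy.unlock. Qed.

Lemma DxE v f p : Dx v f p = 'D_((v, 0) : TM) f p.
Proof. by rewrite Dx.unlock. Qed.

Lemma dyE i f : dy i f = Dy (delta_mx 0 i) f.
Proof. by rewrite Dy.unlock. Qed.

Lemma dxE i f : dx i f = Dx (delta_mx 0 i) f.
Proof. by rewrite Dx.unlock. Qed.

Lemma Dy0 f p : Dy 0 f p = 0.
Proof. by rewrite DyE; exact: derive0. Qed.

Lemma row_continuous_coord i : continuous (fun v : 'rV[R]_n => v 0 i).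
Proof. by move=> v; exact: coord_continuous. Qed.

Lemma continuous_mulmxr (T : 'M[R]_n) : continuous (fun v : 'rV[R]_n => v *m T).
Proof.
rewrite (_ : (fun v => _) = (fun v : 'rV[R]_n => \sum_i v 0 i *: row i T)).
  apply: continuous_big => [|i _ v]; first exact: add_continuous.
  exact: (cvgZr_tmp (@row_continuous_coord i v)).
by apply/funext => v; rewrite mulmx_sum_row.
Qed.

Lemma continuous_dotr w : continuous (fun v : 'rV[R]_n => dot v w).
Proof.
rewrite (_ : (fun v => _) = (fun v : 'rV[R]_n => \sum_i v 0 i * w 0 i)).
  apply: continuous_big => [|i _ v]; first exact: add_continuous.
  exact: (cvgM (@row_continuous_coord i v) (cvg_cst _)).
by apply/funext => v; rewrite dotE.
Qed.

Lemma open_slit (Omega : set 'rV[R]_n) : open Omega -> open (slit Omega).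
Proof.
move=> oO; rewrite (_ : slit Omega = fst @^-1` Omega `&` snd @^-1` ~` [set 0]).
  apply: openI; apply: open_comp => //.
  - by move=> p _; exact: cvg_fst.
  - by move=> p _; exact: cvg_snd.
  - by apply: closed_openC; apply: accessible_closed_set1; exact: hausdorff_accessible.
by apply/seteqP; split=> p /= [Op /eqP y0]; split=> //; exact/eqP.
Qed.

Lemma smooth_dot_snd (A : set TM) w : open A -> smooth_on A (fun p => dot p.2 w).
Proof.
move=> oA; apply: smooth_linear => // [p|c u v].
  apply: (@continuous_comp _ _ _ snd (fun v => dot v w)); first exact: cvg_snd.
  exact: continuous_dotr.
by rewrite dotDl dotZl.
Qed.

Lemma Dy_dot_snd v w p : Dy v (fun q => dot q.2 w) p = dot v w.
Proof.
by rewrite DyE derive_linear// => c u u'; rewrite dotDl dotZl.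
Qed.

Lemma smooth_coord_snd (A : set TM) i : open A -> smooth_on A (fun p => p.2 0 i).
Proof.
move=> oA; apply: eq_smooth (smooth_dot_snd (delta_mx 0 i) oA) => // q _.
by rewrite dot_delta.
Qed.

Lemma Dy_coord_snd v i p : Dy v (fun q => q.2 0 i) p = v 0 i.
Proof.
rewrite (_ : (fun q => _) = (fun q : TM => dot q.2 (delta_mx 0 i))).
  by rewrite Dy_dot_snd dot_delta.
by apply/funext => q; rewrite dot_delta.
Qed.

Context {A : set TM} (oA : open A).

Lemma Dy_sum v f p : smooth_on A f -> A p -> Dy v f p = \sum_i v 0 i * Dy (delta_mx 0 i) f p.
Proof.
move=> sf Ap; under eq_bigr do rewrite DyE.
rewrite DyE -(derive_dir_sum oA _ _ _ sf Ap); congr ('D_ _ f p).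
rewrite {1}(row_sum_delta v); elim/big_rec2: _ => // i _ a _ <-.
by apply: injective_projections; rewrite /= ?scaler0 ?add0r.
Qed.

Lemma Dx_sum v f p : smooth_on A f -> A p -> Dx v f p = \sum_i v 0 i * Dx (delta_mx 0 i) f p.
Proof.
move=> sf Ap; under eq_bigr do rewrite DxE.
rewrite DxE -(derive_dir_sum oA _ _ _ sf Ap); congr ('D_ _ f p).
rewrite {1}(row_sum_delta v); elim/big_rec2: _ => // i _ a _ <-.
by apply: injective_projections; rewrite /= ?scaler0 ?add0r.
Qed.

Lemma DyD u v f p : smooth_on A f -> A p -> Dy (u + v) f p = Dy u f p + Dy v f p.
Proof.
have E : ((0, u + v) : TM) = (0, u) + (0, v).
  by apply: injective_projections; rewrite /= ?addr0.
by rewrite !DyE E; exact: derive_dirD.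
Qed.

Lemma DyZ (c : R) v f p : smooth_on A f -> A p -> Dy (c *: v) f p = c * Dy v f p.
Proof.
have E : ((0, c *: v) : TM) = c *: (0, v).
  by apply: injective_projections; rewrite /= ?scaler0.
by rewrite !DyE E; exact: derive_dirZ.
Qed.

Lemma Dxy u v f p : smooth_on A f -> A p ->
  'D_((u, v) : TM) f p = Dx u f p + Dy v f p.
Proof.
have E : ((u, v) : TM) = (u, 0) + (0, v).
  by apply: injective_projections; rewrite /= ?addr0 ?add0r.
by rewrite DyE DxE E; exact: derive_dirD.
Qed.

Lemma DxZ (c : R) v f p : smooth_on A f -> A p -> Dx (c *: v) f p = c * Dx v f p.
Proof.
have E : ((c *: v, 0) : TM) = c *: (v, 0).
  by apply: injective_projections; rewrite /= ?scaler0.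
by rewrite !DxE E; exact: derive_dirZ.
Qed.

Lemma smooth_Dy v f : smooth_on A f -> smooth_on A (Dy v f).
Proof. by move=> sf; rewrite Dy.unlock; exact: smooth_derive. Qed.

Lemma smooth_Dx v f : smooth_on A f -> smooth_on A (Dx v f).
Proof. by move=> sf; rewrite Dx.unlock; exact: smooth_derive. Qed.

Lemma eq_Dy v f h p : (forall q, A q -> f q = h q) -> A p -> Dy v f p = Dy v h p.
Proof. by move=> fh Ap; rewrite !DyE; exact: eq_derive_on fh Ap. Qed.

Lemma Dy_sumf (I : Type) (r : seq I) (h : I -> TM -> R) v p :
  (forall i, smooth_on A (h i)) -> A p ->
  Dy v (fun q => \sum_(i <- r) h i q) p = \sum_(i <- r) Dy v (h i) p.
Proof.
move=> sh Ap; rewrite DyE (derive_sumE oA _ _ sh Ap).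
by apply: eq_bigr => i _; rewrite DyE.
Qed.

Lemma DyZf (c : R) v f p : smooth_on A f -> A p ->
  Dy v (fun q => c * f q) p = c * Dy v f p.
Proof. by move=> sf Ap; rewrite !DyE (deriveZE _ _ sf Ap). Qed.

Lemma DyMf v f h p : smooth_on A f -> smooth_on A h -> A p ->
  Dy v (fun q => f q * h q) p = f p * Dy v h p + h p * Dy v f p.
Proof. by move=> sf sh Ap; rewrite !DyE (deriveME _ sf sh Ap). Qed.

Lemma DyBf v f h p : smooth_on A f -> smooth_on A h -> A p ->
  Dy v (fun q => f q - h q) p = Dy v f p - Dy v h p.
Proof. by move=> sf sh Ap; rewrite !DyE (deriveBE _ sf sh Ap). Qed.

Lemma is_derive_vertical f x y v (s : R) : smooth_on A f -> A (x, y + s *: v) ->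
  is_derive s 1 (fun t : R => f (x, y + t *: v)) (Dy v f (x, y + s *: v)).
Proof.
move=> sf Ap.
have E t : (x, y + t *: v) = (x, y) + t *: ((0, v) : TM).
  by apply: injective_projections; rewrite /= ?scaler0 ?addr0.
rewrite DyE E (_ : (fun t : R => _) = (fun t : R => f ((x, y) + t *: ((0, v) : TM)))).
  by apply: is_derive_line; rewrite -E; exact: smooth_derivable sf Ap.
by apply/funext => t; rewrite E.
Qed.

End TangentBundle.

(** * Positive homogeneity in the fibre and Euler's theorem *)

Section Homogeneous.
Context {R : realType} {n : nat} (Omega : set 'rV[R]_n) (oO : open Omega).
Notation TM := ('rV[R]_n * 'rV[R]_n)%type.
Implicit Types (f h : TM -> R) (u v w : 'rV[R]_n) (p q : TM).

Definition homogeneous k f := forall x y (c : R), Omega x -> y != 0 -> 0 < c ->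
  f (x, c *: y) = c ^+ k * f (x, y).

Let oS := open_slit oO.

(** Chain rule for the fibre dilation [(x, y) |-> (x, c y)]. Vertical directions pick up a factor
    [c], so [Dy] lowers the degree by one; [Dx] preserves it. *)
Lemma homogeneous_scale k f p (c : R) (w : TM) : homogeneous k f -> smooth_on (slit Omega) f ->
  slit Omega p -> 0 < c ->
  'D_((w.1, c *: w.2) : TM) f (p.1, c *: p.2) = c ^+ k * 'D_w f p.
Proof.
move=> hf sf Ap c0; pose L (q : TM) : TM := (q.1, c *: q.2).
rewrite -[LHS]/('D_(L w) f (L p)) derive_comp_linear; last first.
  move=> d u v; apply: injective_projections => //=.
  by rewrite scalerDr !scalerA mulrC.
rewrite -(deriveZE _ _ sf Ap); apply: (eq_derive_on oS) => // -[x y] [Ox y0].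
exact: hf.
Qed.

Lemma homogeneous_Dy k f v : homogeneous k.+1 f -> smooth_on (slit Omega) f ->
  homogeneous k (Dy v f).
Proof.
move=> hf sf x y c Ox y0 c0; have Ap : slit Omega (x, y) by [].
have Acp : slit Omega (x, c *: y) by split=> //=; rewrite scaler_eq0 negb_or gt_eqF.
have := homogeneous_scale ((0, v) : TM) hf sf Ap c0.
rewrite /= -!DyE (DyZ oS)// exprS -mulrA.
by apply: mulfI; rewrite gt_eqF.
Qed.

Lemma homogeneous_Dx k f v : homogeneous k f -> smooth_on (slit Omega) f ->
  homogeneous k (Dx v f).
Proof.
move=> hf sf x y c Ox y0 c0; have Ap : slit Omega (x, y) by [].
by have := homogeneous_scale ((v, 0) : TM) hf sf Ap c0; rewrite /= scaler0 -!DxE.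
Qed.

(** Differentiate [f (x, y + t y) = (1 + t)^k f (x, y)], valid for [|t| < 1], at [t = 0]. *)
Lemma Euler k f x y : homogeneous k f -> smooth_on (slit Omega) f ->
  slit Omega (x, y) -> Dy y f (x, y) = k%:R * f (x, y).
Proof.
move=> hf sf Ap; have [Ox y0] := Ap.
have := @is_derive_vertical _ _ _ f x y y 0 sf.
rewrite scale0r addr0 => /(_ Ap)[_ <-].
have D : is_derive (0 : R) 1 (fun t : R => (1 + t) ^+ k * f (x, y)) (k%:R * f (x, y)).
  have -> : (fun t : R => (1 + t) ^+ k * f (x, y)) =
      f (x, y) \*: ((cst 1 + id : R -> R) ^+ k).
    by apply/funext => t; rewrite mulrC /= exprfctE.
  apply: is_derive_eq; rewrite /GRing.scale/= !fctE/= add0r addr0 expr1n !mulr1.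
  by rewrite mulrC.
rewrite -[RHS](derive_val (is_derive := D)).
apply: near_eq_derive; near=> t.
rewrite -{1}[y]scale1r -scalerDl hf//.
have : `|t| < 1 by near: t; exists 1 => //= t; rewrite /ball_/= sub0r normrN.
by rewrite ltr_norml => /andP[? _]; lra.
Unshelve. all: by end_near. Qed.

End Homogeneous.

(** * The geodesic spray *)

Section Spray.
Context {R : realType} {n : nat} (Omega : set 'rV[R]_n) (F : 'rV[R]_n * 'rV[R]_n -> R).
Context (oO : open Omega).
Context (rF : regular_Finsler Omega F).
Notation TM := ('rV[R]_n * 'rV[R]_n)%type.
Notation S := (sq F).
Local Notation e_ i := (delta_mx 0 i).
Implicit Types (u v w x y : 'rV[R]_n) (p q : TM).

Definition spray_vector p : 'rV[R]_n := \row_i spray F i p.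
Notation G := spray_vector.

Let oS : open (slit Omega) := open_slit oO.

Lemma smooth_sq : smooth_on (slit Omega) S.
Proof.
have [sF _ _ _] := rF.
by apply: eq_smooth oS _ _ _ (smoothM oS sF sF) => q _; rewrite /sq expr2.
Qed.
Let sS := smooth_sq.

(** The coefficients of [w] are moved outside all derivatives, so that a vector computed at [p],
    such as [G p], can be used as a constant direction. *)
Lemma Dy_frozen v w f p : smooth_on (slit Omega) f -> slit Omega p ->
  Dy v (Dy w f) p = \sum_i w 0 i * Dy v (Dy (e_ i) f) p.
Proof.
move=> sf Ap.
transitivity (Dy v (fun q => \sum_i w 0 i * Dy (e_ i) f q) p).
  by apply: (eq_Dy oS _ _ Ap) => q Aq; exact: (Dy_sum oS w sf Aq).
have sm i : smooth_on (slit Omega) (fun q => w 0 i * Dy (e_ i) f q).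
  exact: (smoothZ oS _ (smooth_Dy _ sf)).
rewrite (Dy_sumf oS _ _ sm Ap).
by apply: eq_bigr => j _; rewrite (DyZf _ _ (smooth_Dy _ sf) Ap).
Qed.

Lemma Dy_frozenx v w f p : smooth_on (slit Omega) f -> slit Omega p ->
  Dy v (Dx w f) p = \sum_i w 0 i * Dy v (Dx (e_ i) f) p.
Proof.
move=> sf Ap.
transitivity (Dy v (fun q => \sum_i w 0 i * Dx (e_ i) f q) p).
  by apply: (eq_Dy oS _ _ Ap) => q Aq; exact: (Dx_sum oS w sf Aq).
have sm i : smooth_on (slit Omega) (fun q => w 0 i * Dx (e_ i) f q).
  exact: (smoothZ oS _ (smooth_Dx _ sf)).
rewrite (Dy_sumf oS _ _ sm Ap).
by apply: eq_bigr => j _; rewrite (DyZf _ _ (smooth_Dx _ sf) Ap).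
Qed.

Lemma homogeneous_sq : homogeneous Omega 2 S.
Proof.
by move=> x y c Ox y0 c0; have [_ _ hF _] := rF; rewrite /sq hF// exprMn.
Qed.

Lemma sq_gt0 p : slit Omega p -> 0 < S p.
Proof. by move=> Ap; have [_ F0 _ _] := rF; rewrite exprn_gt0// F0. Qed.

Lemma fundamental_tensor_quadratic v p : slit Omega p ->
  Dy v (Dy v S) p = 2 * (v *m fundamental_tensor F p *m v^T) 0 0.
Proof.
move=> Ap; rewrite (Dy_sum oS v (smooth_Dy v sS) Ap).
rewrite mxE mulr_sumr; under [RHS]eq_bigr => j _.
  rewrite mxE [X in 2 * X]mulr_suml mulr_sumr; over.
rewrite /= exchange_big/=; apply: eq_bigr => i _.
rewrite (Dy_frozen (e_ i) v sS Ap) mulr_sumr.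
apply: eq_bigr => j _; rewrite !mxE !dyE; by field.
Qed.

Lemma Dy2_gt0 v p : slit Omega p -> v != 0 -> 0 < Dy v (Dy v S) p.
Proof.
move=> Ap v0; have [_ _ _ pF] := rF.
by rewrite fundamental_tensor_quadratic// mulr_gt0// pF.
Qed.

Lemma fundamental_tensor_unit p : slit Omega p -> fundamental_tensor F p \in unitmx.
Proof.
move=> Ap; have [_ _ _ /(_ _ Ap) pF] := rF.
rewrite -row_free_unit -kermx_eq0; apply: contraT => /rowV0Pn[v].
rewrite sub_kermx => /eqP vg v0.
by have := pF _ v0; rewrite vg mul0mx mxE ltxx.
Qed.

Lemma smooth_det m (M : TM -> 'M[R]_m) : (forall i j, smooth_on (slit Omega) (fun p => M p i j)) ->
  smooth_on (slit Omega) (fun p => \det (M p)).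
Proof.
move=> sM; apply: (smooth_sum oS) => s.
exact: (smoothZ oS _ (smooth_prod oS _ _ (fun i => sM i _))).
Qed.

(** Cramer's rule: entries of the inverse are cofactors divided by the determinant. *)
Lemma smooth_invmx (M : TM -> 'M[R]_n) i j :
  (forall p, slit Omega p -> M p \in unitmx) ->
  (forall i j, smooth_on (slit Omega) (fun p => M p i j)) ->
  smooth_on (slit Omega) (fun p => invmx (M p) i j).
Proof.
move=> uM sM.
have d0 p : slit Omega p -> \det (M p) != 0.
  by move=> /uM; rewrite unitmxE unitfE.
have sc : smooth_on (slit Omega) (fun p => cofactor (M p) j i).
  apply: (smoothZ oS); apply: smooth_det => k l.
  by apply: eq_smooth oS _ _ _ (sM (lift j k) (lift i l)) => p _; rewrite !mxE.
apply: eq_smooth oS _ _ _ (smoothM oS (smoothV oS d0 (smooth_det sM)) sc) => p Ap.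
by rewrite /invmx uM// !mxE.
Qed.

Lemma smooth_spray i : smooth_on (slit Omega) (spray F i).
Proof.
apply: (smoothZ oS); apply: (smooth_sum oS) => l.
apply: (smoothM oS (f := fun p => invmx (fundamental_tensor F p) i l)
  (g := fun p => \sum_k dy l (dx k S) p * p.2 0 k - dx l S p)).
  apply: smooth_invmx => [p|a b]; first exact: fundamental_tensor_unit.
  apply: eq_smooth oS _ _ _ (smoothZ oS 2^-1 (smooth_Dy (e_ a) (smooth_Dy (e_ b) sS))) => p _.
  by rewrite !mxE !dyE.
rewrite dxE; under eq_fun do under eq_bigr do rewrite dyE dxE.
apply: (smoothB oS _ (smooth_Dx _ sS)); apply: (smooth_sum oS) => k.
exact: (smoothM oS (smooth_Dy _ (smooth_Dx _ sS)) (smooth_coord_snd k oS)).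
Qed.

(** The definition of the spray multiplied by [g], which is half the vertical Hessian of [S]; the
    factors 1/4 and 1/2 combine into the 2. *)
Lemma spray_equation l p : slit Omega p ->
  2 * \sum_i spray F i p * Dy (e_ l) (Dy (e_ i) S) p =
  \sum_k p.2 0 k * Dy (e_ l) (Dx (e_ k) S) p - Dx (e_ l) S p.
Proof.
move=> Ap; rewrite -dxE; under eq_bigr do rewrite -!dyE.
under [in RHS]eq_bigr do rewrite -dxE -dyE.
set g := fundamental_tensor F p.
pose omega : 'cV[R]_n := \col_l (\sum_k dy l (dx k S) p * p.2 0 k - dx l S p).
have GE i : spray F i p = 4^-1 * (invmx g *m omega) i 0.
  by rewrite /spray mxE; congr (_ * _); apply: eq_bigr => j _; rewrite !mxE.
have /matrixP/(_ l 0) : g *m (invmx g *m omega) = omega.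
  by rewrite mulKVmx// fundamental_tensor_unit.
rewrite [RHS]mxE mxE => E.
under [X in _ = X - _]eq_bigr => k _ do rewrite mulrC.
rewrite -E mulr_sumr; apply: eq_bigr => i _.
by rewrite GE [g l i]mxE; field.
Qed.

(* [G p] and [p.2] are frozen: only [S] is differentiated. *)
Lemma spray_char v p : slit Omega p ->
  2 * Dy v (Dy (G p) S) p = Dy v (Dx p.2 S) p - Dx v S p.
Proof.
move=> Ap; rewrite (Dy_sum oS v (smooth_Dy (G p) sS) Ap).
rewrite (Dy_sum oS v (smooth_Dx p.2 sS) Ap).
rewrite (Dx_sum oS v sS Ap) -sumrB mulr_sumr; apply: eq_bigr => l _.
rewrite -mulrBr mulrCA; congr (_ * _).
rewrite -[Dy (e_ l) _ p]/(Dy (delta_mx 0 l) _ p) -[Dy (e_ l) (Dx _ _) p]/(Dy (delta_mx 0 l) _ p).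
rewrite (Dy_frozen _ _ sS Ap) (Dy_frozenx _ _ sS Ap) -(spray_equation l Ap).
by congr (_ * _); apply: eq_bigr => i _; rewrite mxE.
Qed.

(** The difference of two solutions is isotropic for the vertical Hessian of [S], which is positive
    definite. This identifies sprays after a dilation or an isometry without handling the inverse
    matrix. *)
Lemma spray_char_unique p g : slit Omega p ->
  (forall v, 2 * Dy v (Dy g S) p = Dy v (Dx p.2 S) p - Dx v S p) -> g = G p.
Proof.
move=> Ap Hg; apply/eqP; rewrite -subr_eq0; apply: contraT => d0.
have := Dy2_gt0 Ap d0; suff -> : Dy (g - G p) (Dy (g - G p) S) p = 0 by rewrite ltxx.
set v := g - G p; have E : Dy v (Dy g S) p = Dy v (Dy (G p) S) p.
  have := Hg v; rewrite -(spray_char v Ap).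
  by apply: mulfI; rewrite pnatr_eq0.
rewrite (Dy_frozen _ _ sS Ap); rewrite !(Dy_frozen _ _ sS Ap) in E.
under eq_bigr => i _ do rewrite 2!mxE mulrDl mulNr.
by rewrite big_split/= sumrN E subrr.
Qed.

(** Take [v = y] in [spray_char]: [Dy w S] has degree 1 and [Dx w S] degree 2, so Euler's theorem
    removes the outer derivatives. *)
Lemma spray_contract p : slit Omega p ->
  2 * \sum_i spray F i p * Dy (e_ i) S p = \sum_k p.2 0 k * Dx (e_ k) S p.
Proof.
case: p => x y Ap; have := spray_char y Ap.
have h1 w : homogeneous Omega 1 (Dy w S).
  exact: (homogeneous_Dy oO (k := 1) w homogeneous_sq sS).
have h2 w : homogeneous Omega 2 (Dx w S).
  exact: (homogeneous_Dx oO w homogeneous_sq sS).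
rewrite (Euler (h1 _) (smooth_Dy _ sS) Ap) (Euler (h2 _) (smooth_Dx _ sS) Ap).
rewrite mul1r (Dy_sum oS _ sS Ap) (Dx_sum oS _ sS Ap)/= => E.
transitivity (2 * \sum_i G (x, y) 0 i * Dy (e_ i) S (x, y)).
  by congr (_ * _); apply: eq_bigr => i _; rewrite mxE.
rewrite E; ring.
Qed.

Lemma Dy_sum_mul v (g h : 'I_n -> TM -> R) p :
  (forall i, smooth_on (slit Omega) (g i)) -> (forall i, smooth_on (slit Omega) (h i)) ->
  slit Omega p ->
  Dy v (fun q => \sum_i g i q * h i q) p =
  \sum_i g i p * Dy v (h i) p + \sum_i h i p * Dy v (g i) p.
Proof.
move=> sg sh Ap; have sm i : smooth_on (slit Omega) (fun q => g i q * h i q).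
  exact: (smoothM oS (sg i) (sh i)).
rewrite (Dy_sumf oS _ v sm Ap) -big_split/=.
by apply: eq_bigr => i _; rewrite (DyMf v (sg i) (sh i) Ap).
Qed.

Lemma Dy_sum_mul_eq v (g h c k : 'I_n -> TM -> R) p :
  (forall i, smooth_on (slit Omega) (g i)) -> (forall i, smooth_on (slit Omega) (h i)) ->
  (forall i, smooth_on (slit Omega) (c i)) -> (forall i, smooth_on (slit Omega) (k i)) ->
  (forall q, slit Omega q -> 2 * \sum_i g i q * h i q = \sum_i c i q * k i q) ->
  slit Omega p ->
  2 * (\sum_i g i p * Dy v (h i) p + \sum_i h i p * Dy v (g i) p) =
  \sum_i c i p * Dy v (k i) p + \sum_i k i p * Dy v (c i) p.
Proof.
move=> sg sh sc sk E Ap.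
rewrite -(Dy_sum_mul v sg sh Ap) -(Dy_sum_mul v sc sk Ap).
have sm i : smooth_on (slit Omega) (fun q => g i q * h i q).
  exact: (smoothM oS (sg i) (sh i)).
rewrite -(DyZf 2 v (smooth_sum oS _ _ sm) Ap).
exact: (eq_Dy oS v E Ap).
Qed.

(* The horizontal derivative of [F^2] vanishes. *)
Lemma horizontal_sq v p : slit Omega p ->
  \sum_i Dy v (spray F i) p * Dy (e_ i) S p = Dx v S p.
Proof.
move=> Ap.
(* Differentiate [spray_contract] along [v]; the second derivatives of [S] that appear cancel
   through [spray_char]. *)
have := Dy_sum_mul_eq v smooth_spray (fun i => smooth_Dy (e_ i) sS)
  (fun i => smooth_coord_snd i oS) (fun i => smooth_Dx (e_ i) sS)
  (@spray_contract) Ap.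
have := spray_char v Ap.
rewrite (Dy_frozen v (G p) sS Ap) (Dy_frozenx v p.2 sS Ap) (Dx_sum oS v sS Ap).
rewrite [X in 2 * X](eq_bigr (fun i => spray F i p * Dy v (Dy (e_ i) S) p)); last first.
  by move=> i _; rewrite mxE.
rewrite [X in _ -> _ = _ + X -> _](eq_bigr (fun i => v 0 i * Dx (e_ i) S p)); last first.
  by move=> i _; rewrite Dy_coord_snd mulrC.
rewrite [X in _ -> _ -> X = _](eq_bigr (fun i => Dy (e_ i) S p * Dy v (spray F i) p)); last first.
  by move=> i _; rewrite mulrC.
move: (\sum_i spray F i p * Dy v (Dy (e_ i) S) p) (\sum_i p.2 0 i * Dy v (Dx (e_ i) S) p) => a b.
move: (\sum_i v 0 i * Dx (e_ i) S p) (\sum_i Dy (e_ i) S p * Dy v (spray F i) p) => c d.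
by move=> E1; rewrite mulrDr E1 => E2; lra.
Qed.

End Spray.

(** * Consequences of spherical symmetry *)

Section Symmetry.
Context {R : realType} {n : nat} (Omega : set 'rV[R]_n) (F : 'rV[R]_n * 'rV[R]_n -> R).
Context (n3 : (3 <= n)%N).
Context (oO : open Omega).
Context (rF : regular_Finsler Omega F).
Context (sF : spherically_symmetric Omega F).
Notation TM := ('rV[R]_n * 'rV[R]_n)%type.
Notation S := (sq F).
Notation G := (spray_vector F).
Implicit Types (u v w x y : 'rV[R]_n) (p q : TM) (f h : TM -> R).

Let oS : open (slit Omega) := open_slit oO.
Let sS : smooth_on (slit Omega) S := smooth_sq oO rF.

Definition act (T : 'M[R]_n) p : TM := (p.1 *m T, p.2 *m T).

Lemma sq_act T p : orthogonal_mx T -> Omega p.1 -> Omega (p.1 *m T) -> S (act T p) = S p.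
Proof. by case: p => x y oT Ox OxT; rewrite /sq /act (orthogonal_invariant y n3 sF oT). Qed.

Lemma mulmx_orthogonal_eq0 (T : 'M[R]_n) v : orthogonal_mx T -> (v *m T == 0) = (v == 0).
Proof.
move=> oT; apply/eqP/eqP => [vT|->]; last by rewrite mul0mx.
by rewrite -[v]mulmx1 -oT mulmxA vT mul0mx.
Qed.

Lemma slit_act T p : orthogonal_mx T -> slit Omega p -> Omega (p.1 *m T) ->
  slit Omega (act T p).
Proof. by move=> oT [Op p0] OT; split=> //; rewrite /act/= mulmx_orthogonal_eq0. Qed.

(** [f] and [h] are kept apart so that the rule can be iterated, with first derivatives of [S] in
    the moved and the original direction as the new pair. *)
Lemma derive_act (T : 'M[R]_n) (U : set TM) f h (w : TM) p : open U -> U p ->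
  (forall q, U q -> f (act T q) = h q) ->
  'D_(act T w) f (act T p) = 'D_w h p.
Proof.
move=> oU Up fh; rewrite derive_comp_linear; first exact: (eq_derive_on oU _ fh Up).
by move=> c u v; apply: injective_projections; rewrite /= mulmxDl -scalemxAl.
Qed.

Lemma Dy_act (T : 'M[R]_n) (U : set TM) f h v p : open U -> U p ->
  (forall q, U q -> f (act T q) = h q) -> Dy (v *m T) f (act T p) = Dy v h p.
Proof.
move=> oU Up fh; have := derive_act (0, v) oU Up fh.
by rewrite !DyE (_ : act T (0, v) = (0, v *m T))// /act/= mul0mx.
Qed.

Lemma Dx_act (T : 'M[R]_n) (U : set TM) f h v p : open U -> U p ->
  (forall q, U q -> f (act T q) = h q) -> Dx (v *m T) f (act T p) = Dx v h p.
Proof.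
move=> oU Up fh; have := derive_act (v, 0) oU Up fh.
by rewrite !DxE (_ : act T (v, 0) = (v *m T, 0))// /act/= mul0mx.
Qed.

Lemma open_meet_act (T : 'M[R]_n) : open [set x | Omega x /\ Omega (x *m T)].
Proof.
apply: openI => //; apply: (open_comp (f := fun x => x *m T)) => // x _.
exact: continuous_mulmxr.
Qed.

(** An isometry carries the characteristic equation of the spray into itself, so uniqueness
    transports [G]. *)
Lemma spray_act T p : orthogonal_mx T -> slit Omega p -> Omega (p.1 *m T) ->
  G (act T p) = G p *m T.
Proof.
move=> oT Ap OT; apply/esym/(spray_char_unique oO rF); first exact: slit_act.
(* [Omega] may fail to be invariant. Over [U] both [x] and its image lie in [Omega], and [U] is
   open, so the symmetry of [S] can be differentiated there. *)
pose U := slit [set x | Omega x /\ Omega (x *m T)].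
have oU : open U := open_slit (@open_meet_act T).
have Up : U p by case: Ap => ? ?; split.
have SU q : U q -> S (act T q) = S q by move=> [[? ?] _]; exact: sq_act.
have Dy1 v q : U q -> Dy (v *m T) S (act T q) = Dy v S q.
  by move=> Uq; exact: Dy_act oU Uq SU.
have Dx1 v q : U q -> Dx (v *m T) S (act T q) = Dx v S q.
  by move=> Uq; exact: Dx_act oU Uq SU.
move=> v; have -> : v = v *m T^T *m T by rewrite -mulmxA (mulmx1C oT) mulmx1.
move: (v *m T^T) => {}v.
rewrite (Dy_act v oU Up (Dy1 (G p))) (Dy_act v oU Up (Dx1 p.2)) Dx1//.
exact: (spray_char oO rF v Ap).
Qed.

Lemma reflection_fix x w : dot x w = 0 -> x *m reflection w = x.
Proof. by move=> xw; rewrite mul_reflection xw mulr0 scale0r subr0. Qed.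

Lemma act_reflection p w : dot p.1 w = 0 -> dot p.2 w = 0 -> act (reflection w) p = p.
Proof. by case: p => x y /= xw yw; rewrite /act/= !reflection_fix. Qed.

Lemma unit_scale w : w != 0 -> exists2 w', dot w' w' = 1 &
  exists2 c, 0 < c & w = c *: w'.
Proof.
move=> w0; have s0 : 0 < Num.sqrt (dot w w) by rewrite sqrtr_gt0 dot_gt0.
exists ((Num.sqrt (dot w w))^-1 *: w).
  rewrite !dot_lin mulrA -invfM -expr2 sqr_sqrtr ?ltW ?dot_gt0// mulVf//.
  by rewrite gt_eqF// dot_gt0.
by exists (Num.sqrt (dot w w)) => //; rewrite scalerA mulfV ?scale1r// gt_eqF.
Qed.

(** The reflection along [w] fixes [x] and [y], hence [G], while it negates the component of [G]
    along [w]. *)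
Lemma spray_perp p w : slit Omega p -> dot p.1 w = 0 -> dot p.2 w = 0 -> dot (G p) w = 0.
Proof.
move=> Ap xw yw; have [->|w0] := eqVneq w 0; first by rewrite dotC dot0l.
have [v v1 [c /gt_eqF/negbT c0 wE]] := unit_scale w0.
have xv : dot p.1 v = 0.
  by apply: (mulfI c0); rewrite mulr0 -dotZr -wE.
have yv : dot p.2 v = 0.
  by apply: (mulfI c0); rewrite mulr0 -dotZr -wE.
have := spray_act (reflection_orthogonal v1) Ap.
rewrite (reflection_fix xv) (act_reflection xv yv) => /(_ Ap.1).
rewrite mul_reflection => /(congr1 (dot^~ v)); rewrite !dot_lin v1 => E.
have d0 : dot (G p) v = 0 by lra.
by rewrite wE dotZr d0 mulr0.
Qed.

(** The same reflection fixes the point and reverses the direction, so the derivative equals its own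
    opposite. *)
Lemma sq_perp p w : slit Omega p -> dot p.1 w = 0 -> dot p.2 w = 0 -> Dy w S p = 0.
Proof.
move=> Ap xw yw; have [->|w0] := eqVneq w 0; first by rewrite Dy0.
have [v v1 [c /gt_eqF/negbT c0 wE]] := unit_scale w0.
have xv : dot p.1 v = 0.
  by apply: (mulfI c0); rewrite mulr0 -dotZr -wE.
have yv : dot p.2 v = 0.
  by apply: (mulfI c0); rewrite mulr0 -dotZr -wE.
have oT := reflection_orthogonal v1.
pose U := slit [set x | Omega x /\ Omega (x *m reflection v)].
have oU : open U := open_slit (@open_meet_act (reflection v)).
have Up : U p by case: Ap => ? ?; split=> //; split=> //; rewrite reflection_fix.
have SU q : U q -> S (act (reflection v) q) = S q by move=> [[? ?] _]; exact: sq_act.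
have := Dy_act v oU Up SU.
rewrite (act_reflection xv yv) mul_reflection v1.
rewrite mulr1 -[X in X - _]scale1r -scalerBl !(DyZ oS _ _ sS Ap) => E.
have d0 : Dy v S p = 0 by lra.
by rewrite wE (DyZ oS _ _ sS Ap) d0 mulr0.
Qed.

Lemma is_derive_cosB1 : is_derive (0 : R) 1 (fun t => cos t - 1) 0.
Proof.
have := is_deriveB (is_derive_cos (0 : R)) (is_derive_cst (1 : R) (0 : R) 1).
by rewrite sin0 oppr0 addr0.
Qed.

Lemma is_derive_sin0 : is_derive (0 : R) 1 (@sin R) 1.
Proof. by have := is_derive_sin (0 : R); rewrite cos0. Qed.

(** Infinitesimal generator of [plane_rotation u v] at [t = 0]. *)
Definition turn u v x : 'rV[R]_n := dot x u *: v - dot x v *: u.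

Lemma is_derive_rotation u v f p : smooth_on (slit Omega) f -> slit Omega p ->
  is_derive (0 : R) 1 (fun t => f (act (plane_rotation u v t) p))
    ('D_((turn u v p.1, turn u v p.2) : TM) f p).
Proof.
move=> sf Ap.
pose a x := dot x u *: u + dot x v *: v.
have := @is_derive_curve R _ _ oS f p ((a p.1, a p.2) : TM)
  ((turn u v p.1, turn u v p.2) : TM) (fun t => cos t - 1) sin 0 1 sf Ap.
rewrite cos0 subrr sin0 mul0r add0r mul1r => /(_ erefl erefl).
rewrite (_ : (fun t => f (p + _ + _)) = (fun t => f (act (plane_rotation u v t) p))).
  apply.
    exact: is_derive_cosB1.
  exact: is_derive_sin0.
apply/funext => t; congr f; apply: injective_projections;
  by rewrite /= mul_plane_rotation.
Qed.

Lemma near_rotation u v x : Omega x -> \forall t \near (0 : R), Omega (x *m plane_rotation u v t).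
Proof.
move=> Ox; have c : {for 0, continuous (fun t : R => x *m plane_rotation u v t)}.
  rewrite (_ : (fun t => _) = (fun t => x + (cos t - 1) *: (dot x u *: u + dot x v *: v)
    + sin t *: turn u v x)); last by apply/funext => t; rewrite mul_plane_rotation.
  apply: cvgD; last exact: cvgZr_tmp (@continuous_sin R 0).
  apply: cvgD; first exact: cvg_cst.
  apply: (cvgZr_tmp (s := fun t => cos t - 1)).
  by apply: cvgB; [exact: continuous_cos|exact: cvg_cst].
apply: (c Omega); rewrite plane_rotation0 mulmx1; exact: open_nbhs_nbhs.
Qed.

Lemma sq_turn u v p : dot u u = 1 -> dot v v = 1 -> dot u v = 0 -> slit Omega p ->
  Dx (turn u v p.1) S p + Dy (turn u v p.2) S p = 0.
Proof.
move=> u1 v1 uv Ap; rewrite -(Dxy oS _ _ sS Ap).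
rewrite -[LHS](derive_val (is_derive := is_derive_rotation u v sS Ap)).
rewrite -[RHS](derive_cst (S p) (0 : R) 1); apply: near_eq_derive.
apply: filterS (near_rotation u v Ap.1) => t Ot; rewrite sq_act//; last exact: Ap.1.
exact: plane_rotation_orthogonal.
Qed.

(** These rotations fix [x], so only a vertical derivative remains; equivariance of [G] turns it
    into the generator applied to [G]. *)
Lemma spray_turn u v e p : dot u u = 1 -> dot v v = 1 -> dot u v = 0 ->
  dot p.1 u = 0 -> dot p.1 v = 0 -> slit Omega p ->
  Dy (turn u v p.2) (fun q => dot (G q) e) p = dot (turn u v (G p)) e.
Proof.
move=> u1 v1 uv xu xv Ap.
have sG : smooth_on (slit Omega) (fun q => dot (G q) e).
  apply: eq_smooth oS _ _ _ (smooth_sum oS (index_enum 'I_n) xpredT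
    (fun i => smoothZ oS (e 0 i) (smooth_spray oO rF i))) => q _.
  by rewrite dotE; apply: eq_bigr => i _; rewrite mxE mulrC.
have x0 : turn u v p.1 = 0 by rewrite /turn xu xv !scale0r subrr.
have := is_derive_rotation u v sG Ap; rewrite DyE x0 => -[_ <-].
have H : is_derive (0 : R) 1 (fun t => dot (G p) e +
    (cos t - 1) * dot (dot (G p) u *: u + dot (G p) v *: v) e
    + sin t * dot (turn u v (G p)) e) (dot (turn u v (G p)) e).
  have := is_deriveD (is_deriveD (is_derive_cst (dot (G p) e) (0 : R) 1)
    (is_deriveZ (dot (dot (G p) u *: u + dot (G p) v *: v) e) is_derive_cosB1))
    (is_deriveZ (dot (turn u v (G p)) e) is_derive_sin0).
  rewrite scaler0 !add0r /GRing.scale/= mulr1; congr is_derive.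
  by apply/funext => t; rewrite !fctE /= mulrC [X in _ + X]mulrC.
rewrite -[RHS](derive_val (is_derive := H)); apply: near_eq_derive.
apply: filterS (near_rotation u v Ap.1) => t Ot; rewrite spray_act//.
  by rewrite mul_plane_rotation -/(turn u v (G p)) 2!dotDl (dotZl (cos t - 1)) (dotZl (sin t)).
exact: plane_rotation_orthogonal.
Qed.

End Symmetry.

(** * An overdetermined system on a half-line *)

Section PlaneODE.
Context {R : realType}.
Implicit Types (f : R -> R) (a b x y : R).

Lemma pos_near b : 0 < b -> \forall t \near b, 0 < t.
Proof. exact: lt_nbhsr. Qed.

Lemma eq_is_derive_pos f g b (d e : R) : (forall t, 0 < t -> f t = g t) -> 0 < b ->
  is_derive b 1 f d -> is_derive b 1 g e -> d = e.
Proof.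
move=> fg b0 [_ <-] [_ <-]; apply: near_eq_derive.
by apply: filterS (pos_near b0) => t /fg.
Qed.

Lemma derive0_pos_cst f x y : (forall b, 0 < b -> is_derive b 1 f 0) ->
  0 < x -> 0 < y -> f x = f y.
Proof.
move=> df; wlog xy : x y / x <= y => [H x0 y0|x0 y0].
  by case: (leP x y) => [/H->//|/ltW/H->].
have [||c _] := @MVT_segment R f (cst 0) x y xy.
- by move=> c; rewrite in_itv/= => /andP[xc _]; apply: df; exact: lt_trans xc.
- apply: derivable_within_continuous => c; rewrite in_itv/= => /andP[xc _].
  by have [] := df c (lt_le_trans x0 xc).
by rewrite mul0r => /eqP; rewrite subr_eq0 => /eqP.
Qed.

Lemma derive0_pos_cst0 f x : (forall b, 0 < b -> is_derive b 1 f 0) ->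
  {for 0, continuous f} -> 0 < x -> f x = f 0.
Proof.
move=> df cf x0; apply/eqP; rewrite -subr_eq0 -normr_eq0; apply: contraT => d0.
have e0 : 0 < `|f x - f 0| by rewrite lt_neqAle eq_sym d0 normr_ge0.
move/cvgrPdist_lt : cf => /(_ _ e0) /nbhs_ballP[r /= r0 /(_ (r / 2))].
rewrite /ball/= sub0r normrN gtr0_norm ?divr_gt0// => /(_ _)/wrap[].
  by rewrite ltr_pdivrMr// mulr_natr mulr2n ltrDl.
by rewrite (derive0_pos_cst df (divr_gt0 r0 _) x0)// distrC ltxx.
Qed.

(* Not a class, unlike [is_derive]: its premises must not be inferred. *)
Definition has_derivative f x (d : R) : Prop := is_derive x 1 f d.

Lemma has_derivative_eq f x (d e : R) :
  has_derivative f x d -> d = e -> is_derive x 1 f e.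
Proof. by move=> + <-. Qed.

Lemma has_derivativeM f g x (d e : R) : has_derivative f x d -> has_derivative g x e ->
  has_derivative (fun t => f t * g t) x (f x * e + g x * d).
Proof. by move=> df dg; have := is_deriveM df dg. Qed.

Lemma has_derivativeD f g x (d e : R) : has_derivative f x d -> has_derivative g x e ->
  has_derivative (fun t => f t + g t) x (d + e).
Proof. by move=> df dg; have := is_deriveD df dg. Qed.

Lemma has_derivativeB f g x (d e : R) : has_derivative f x d -> has_derivative g x e ->
  has_derivative (fun t => f t - g t) x (d - e).
Proof. by move=> df dg; have := is_deriveB df dg. Qed.

Lemma has_derivative_cst x (c : R) : has_derivative (fun=> c) x 0.
Proof. exact: is_derive_cst. Qed.

Lemma has_derivative_id x : has_derivative (fun t : R => t) x 1.
Proof. exact: is_derive_id. Qed.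

Lemma has_derivative_inv x : 0 < x ->
  has_derivative (fun t : R => t^-1) x (- (x^-1 * x^-1)).
Proof.
move=> x0; have xn0 : x != 0 by rewrite gt_eqF.
have did : derivable (fun t : R => t) x 1 by exact: derivable_id.
split; first by have := @derivableV R R (fun t => t) x 1 xn0 did.
have := @deriveV R R (fun t => t) x 1 xn0 did.
have -> : 'D_1 (fun t : R => t) x = 1 by exact: derive_id.
by rewrite /GRing.scale/= mulr1 -exprVn expr2.
Qed.

Ltac derive_fun := repeat first
  [eassumption | exact: has_derivative_id | exact: has_derivative_cst
  | exact: has_derivative_inv | apply: has_derivativeM
  | apply: has_derivativeB | apply: has_derivativeD].

(* [K] is [G2], so [b ^+ 2 * K2 - 2 * b * K1 + 2 * K = b ^+ 3 * beta'] and
   [b * K1 - K = b ^+ 2 * beta]; denominators are cleared throughout. *)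
Lemma plane_algebra (a b s1 s2 t1 t2 A1 A2 A3 K K1 K2 K3 rho : R) :
  0 < b -> s2 != 0 -> a * s1 + b * s2 != 0 -> a * t1 + b * t2 = s2 ->
  s1 * (A1 - b * rho) + s2 * (K1 + a * rho) = 0 ->
  t1 * (A1 - b * rho) + s1 * (A2 - rho) + (t2 * (K1 + a * rho) + s2 * K2) = 0 ->
  s1 * (b ^+ 2 * A2 - b * A1) + s2 * (b ^+ 2 * K2 - 2 * b * K1 + 2 * K) = 0 ->
  t1 * (b ^+ 2 * A2 - b * A1) + s1 * (b * A2 - A1 + b ^+ 2 * A3) +
    (t2 * (b ^+ 2 * K2 - 2 * b * K1 + 2 * K) + s2 * (b ^+ 2 * K3)) = 0 ->
  s1 * A3 + s2 * K3 = 0 ->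
  (b ^+ 2 * K2 - 2 * b * K1 + 2 * K) * (b * K1 - K) = 0.
Proof.
move=> b0 s20 e0 eul E1 E1' E2 E2' E3.
set N := b ^+ 2 * K2 - 2 * b * K1 + 2 * K in E2 E2' *.
have bn0 : b != 0 by rewrite gt_eqF.
(* Likewise [m] is [b^2] times the derivative of [A1 / b]. *)
pose m := b * A2 - A1.
have M : b ^+ 2 * A2 - b * A1 = b * m by rewrite /m; ring.
rewrite M in E2 E2'.
(* Subtracting [b^2] times [E3] from [E2'] removes the third derivatives. *)
have X1 : t1 * (b * m) + s1 * m + t2 * N = 0.
  transitivity (t1 * (b * m) + s1 * (b * A2 - A1 + b ^+ 2 * A3) +
    (t2 * N + s2 * (b ^+ 2 * K3)) - b ^+ 2 * (s1 * A3 + s2 * K3)).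
    by rewrite /m; ring.
  by rewrite E2' E3; ring.
(* The Euler relation eliminates [t2], and [E2] the terms in [s1] and [s2]. *)
have X2 : t1 * (b * (b * m) - a * N) = 0.
  transitivity (b * (t1 * (b * m) + s1 * m + t2 * N) - (s1 * (b * m) + s2 * N)
     - (a * t1 + b * t2 - s2) * N); first by ring.
  by rewrite X1 E2 eul; ring.
(* Eliminating [m] between [X2] and [E2] leaves [t1 * N] times [a s1 + b s2]. *)
have t1N : t1 * N = 0.
  apply: (mulfI e0); rewrite mulr0.
  transitivity (- s1 * (t1 * (b * (b * m) - a * N)) + b * t1 * (s1 * (b * m) + s2 * N)).
    by ring.
  by rewrite X2 E2; ring.
(* Multiplied by [N], [E1'] loses its [t1] terms; [E1] and [E2] then remove [A1] and [A2], leaving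
   [s2 N (b^2 K2 - N)], which is twice [s2 N (b K1 - K)]. *)
apply: (mulfI s20); apply: (mulfI (x := 2)); first by rewrite pnatr_eq0.
rewrite !mulr0.
transitivity (b * N * b * (t1 * (A1 - b * rho) + s1 * (A2 - rho) + (t2 * (K1 + a * rho) + s2 * K2))
  - N * (s1 * (b * m) + s2 * N) - b * N * (s1 * (A1 - b * rho) + s2 * (K1 + a * rho))
  - t1 * N * b ^+ 2 * (A1 - b * rho) + a * (t1 * N) * b * (K1 + a * rho)
  - N * b * (K1 + a * rho) * (a * t1 + b * t2 - s2)
  + N * s2 * (N - (b ^+ 2 * K2 - 2 * b * K1 + 2 * K))).
  by rewrite /m; ring.
by rewrite E1 E1' E2 t1N eul /N; ring.
Qed.

(** Here [s1], [s2] play the derivatives of [S] along [e1], [e2], and [A], [K] the components G1,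
    G2; [rho] stands for the inverse of the radial coordinate of [x]. [H] is beta extended to
    [b = 0]. *)
Lemma plane_ode (a rho : R) (s1 s2 t1 t2 A A1 A2 A3 K K1 K2 K3 H : R -> R) :
  (forall b, 0 < b ->
    [/\ is_derive b 1 s1 (t1 b), is_derive b 1 s2 (t2 b),
      s2 b != 0, a * s1 b + b * s2 b != 0 & a * t1 b + b * t2 b = s2 b]) ->
  (forall b, 0 < b -> s1 b = 0 -> t1 b != 0) ->
  (forall b, 0 < b -> [/\ is_derive b 1 A (A1 b), is_derive b 1 A1 (A2 b)
    & is_derive b 1 A2 (A3 b)]) ->
  (forall b, 0 < b -> [/\ is_derive b 1 K (K1 b), is_derive b 1 K1 (K2 b)
    & is_derive b 1 K2 (K3 b)]) ->
  (forall b, 0 < b -> s1 b * (A1 b - b * rho) + s2 b * (K1 b + a * rho) = 0) ->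
  (forall b, 0 < b -> s1 b * (b ^+ 2 * A2 b - b * A1 b) +
    s2 b * (b ^+ 2 * K2 b - 2 * b * K1 b + 2 * K b) = 0) ->
  (forall b, 0 < b -> s1 b * A3 b + s2 b * K3 b = 0) ->
  {for 0, continuous A} -> {for 0, continuous H} -> H 0 = 0 ->
  (forall b, 0 < b -> b ^+ 2 * H b = b * K1 b - K b) ->
  exists c m, forall b, 0 < b -> A b = A 0 + c * b ^+ 2 /\ K b = m * b.
Proof.
move=> Hs Hs1 HA HK E1 E2 E3 cA cH H0 HE.
have zero f b (d : R) : (forall t, 0 < t -> f t = 0) -> 0 < b -> is_derive b 1 f d -> d = 0.
  move=> f0 b0 df; have f00 t : 0 < t -> f t = cst 0 t by move=> /f0.
  exact: eq_is_derive_pos f00 b0 df (has_derivative_cst b 0).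
have NK b : 0 < b -> (b ^+ 2 * K2 b - 2 * b * K1 b + 2 * K b) * (b * K1 b - K b) = 0.
  move=> b0; have [ds1 ds2 s20 e0 eul] := Hs b b0.
  have [dA dA1 dA2] := HA b b0; have [dK dK1 dK2] := HK b b0.
  apply: (@plane_algebra a b (s1 b) (s2 b) (t1 b) (t2 b) (A1 b) (A2 b) (A3 b)
    (K b) (K1 b) (K2 b) (K3 b) rho) => //; [exact: E1| |exact: E2| |exact: E3].
    apply: (zero (fun t => s1 t * (A1 t - t * rho) + s2 t * (K1 t + a * rho)) b) => //.
    by apply: has_derivative_eq; [derive_fun|rewrite /=; ring].
  apply: (zero (fun t => s1 t * (t * t * A2 t - t * A1 t) +
    s2 t * (t * t * K2 t - 2 * t * K1 t + 2 * K t)) b) => //.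
  by apply: has_derivative_eq; [derive_fun|rewrite /=; ring].
pose beta (t : R) := (t * K1 t - K t) * (t^-1 * t^-1).
have betaH t : 0 < t -> beta t = H t.
  move=> t0; rewrite /beta -HE// -invfM -expr2 mulrC mulKf// expf_neq0// gt_eqF//.
(* The derivative of [H^2] is twice beta times its derivative, that is, [2 / b^5] times the product
   in [NK]. *)
have dH b : 0 < b -> is_derive b 1 (fun t => H t * H t) 0.
  move=> b0; apply: (near_eq_is_derive (f := fun t => beta t * beta t)).
    by apply: filterS (pos_near b0) => t /betaH ->.
  have [dK dK1 dK2] := HK b b0; rewrite /beta.
  have bn0 : b != 0 by rewrite gt_eqF.
  apply: has_derivative_eq; [by derive_fun|rewrite /=].
  transitivity (2 * b^-1 ^+ 5 *
    ((b ^+ 2 * K2 b - 2 * b * K1 b + 2 * K b) * (b * K1 b - K b))).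
    by field.
  by rewrite NK// mulr0.
have H0' b : 0 < b -> H b = 0.
  move=> b0; have cHH : {for 0, continuous (fun t => H t * H t)} by exact: (cvgM cH cH).
  have := derive0_pos_cst0 dH cHH b0.
  by rewrite /= H0 mulr0 => /eqP; rewrite mulf_eq0 orbb => /eqP.
have KE b : 0 < b -> b * K1 b - K b = 0 by move=> b0; rewrite -HE// H0'// mulr0.
have ME b : 0 < b -> s1 b * (b * A2 b - A1 b) = 0.
  move=> b0; have bn0 : b != 0 by rewrite gt_eqF.
  have [dK dK1 dK2] := HK b b0.
  have K20 : b * K2 b = 0.
    have D : is_derive b 1 (fun t => t * K1 t - K t) (b * K2 b + K1 b * 1 - K1 b).
      by apply: has_derivative_eq; [derive_fun|].
    by have := zero _ _ _ KE b0 D; rewrite mulr1 addrK.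
  have N0 : b ^+ 2 * K2 b - 2 * b * K1 b + 2 * K b = 0.
    transitivity (b * (b * K2 b) - 2 * (b * K1 b - K b)); first by ring.
    by rewrite K20 KE// !mulr0 subrr.
  apply: (mulfI bn0); have := E2 b b0; rewrite N0 !mulr0 addr0 => <-; ring.
have M0 b : 0 < b -> b * A2 b - A1 b = 0.
  move=> b0; have [ds1 ds2 s20 e0 eul] := Hs b b0.
  have [dA dA1 dA2] := HA b b0.
  (* At a zero of [s1] the relation [ME] is void, but its derivative there is [t1] times the
     unknown, and [t1] is nonzero. *)
  have [s10|s10] := eqVneq (s1 b) 0; last by apply: (mulfI s10); rewrite mulr0 ME.
  apply: (mulfI (Hs1 b b0 s10)); rewrite mulr0.
  have D : is_derive b 1 (fun t => s1 t * (t * A2 t - A1 t))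
      (s1 b * (b * A3 b + A2 b * 1 - A2 b) + (b * A2 b - A1 b) * t1 b).
    by apply: has_derivative_eq; [derive_fun|rewrite /=; ring].
  by have := zero _ _ _ ME b0 D; rewrite s10 mul0r add0r mulrC.
have cK b : 0 < b -> K b * b^-1 = K 1 * 1^-1.
  move=> b0; apply: (derive0_pos_cst (f := fun t => K t * t^-1)) => // t t0.
  have [dK dK1 dK2] := HK t t0; have tn0 : t != 0 by rewrite gt_eqF.
  apply: has_derivative_eq; [by derive_fun|rewrite /=].
  transitivity (t^-1 ^+ 2 * (t * K1 t - K t)); first by field.
  by rewrite KE// mulr0.
have cA1 b : 0 < b -> A1 b * b^-1 = A1 1 * 1^-1.
  move=> b0; apply: (derive0_pos_cst (f := fun t => A1 t * t^-1)) => // t t0.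
  have [dA dA1 dA2] := HA t t0; have tn0 : t != 0 by rewrite gt_eqF.
  apply: has_derivative_eq; [by derive_fun|rewrite /=].
  transitivity (t^-1 ^+ 2 * (t * A2 t - A1 t)); first by field.
  by rewrite M0// mulr0.
(* [A1 / b] and [K / b] equal their values at 1; integrating [A1] halves its coefficient. *)
exists (A1 1 / 2), (K 1) => b b0; have bn0 : b != 0 by rewrite gt_eqF.
split; last by have := cK b b0; rewrite invr1 mulr1 => <-; rewrite mulfVK.
have D (t : R) : 0 < t -> is_derive t 1 (fun u => A u - A1 1 / 2 * (u * u)) 0.
  move=> t0; have [dA dA1 dA2] := HA t t0; have tn0 : t != 0 by rewrite gt_eqF.
  apply: has_derivative_eq; [by derive_fun|rewrite /=].
  have cE : A1 1 = A1 t * t^-1 by rewrite cA1// invr1 mulr1.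
  by rewrite cE; field.
have := derive0_pos_cst0 D _ b0; rewrite !mulr0 subr0 => <-.
  by rewrite expr2; ring.
apply: cvgB; first exact: cA.
by apply: cvgM; [exact: cvg_cst|apply: cvgM; exact: cvg_id].
Qed.

End PlaneODE.

(** * Vertical derivatives within a single fibre *)

Section Fiber.
Context {R : realType} {n : nat}.
Notation TM := ('rV[R]_n * 'rV[R]_n)%type.
Implicit Types (f h : TM -> R) (u v w x y : 'rV[R]_n) (p q : TM).

(** A vertical derivative sees only the fibre over [x], so formulas established for one fixed [x]
    can still be differentiated. *)
Lemma Dy_line v f x y : Dy v f (x, y) = 'D_1 (fun t : R => f (x, y + t *: v)) 0.
Proof.
rewrite DyE /derive.
have -> : (fun h : R => h^-1 *: ((f \o shift (x, y)) (h *: ((0, v) : TM)) - f (x, y))) =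
  (fun h : R => h^-1 *: (((fun t : R => f (x, y + t *: v)) \o shift 0) (h *: 1)
    - f (x, y + 0 *: v))).
  apply/funext => h /=; rewrite [h *: 1]mulr1 addr0 scale0r addr0.
  congr (_ *: (f _ - _)); apply: injective_projections; rewrite /= ?scaler0 ?add0r//.
  by rewrite addrC.
by [].
Qed.

Lemma eq_Dy_fiber (Y : set 'rV[R]_n) v f h x y : open Y ->
  (forall z, Y z -> f (x, z) = h (x, z)) -> Y y -> Dy v f (x, y) = Dy v h (x, y).
Proof.
move=> oY fh Yy; rewrite !Dy_line; apply: near_eq_derive.
have c : {for 0, continuous (fun t : R => y + t *: v)}.
  by apply: cvgD; [exact: cvg_cst|apply: (cvgZr_tmp (s := id)); exact: cvg_id].
have : \forall t \near (0 : R), Y (y + t *: v).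
  by apply: (c Y); rewrite scale0r addr0; exact: open_nbhs_nbhs.
by apply: filterS => t /fh.
Qed.

Lemma eq_Dy_line v f h x y : (forall t : R, f (x, y + t *: v) = h (x, y + t *: v)) ->
  Dy v f (x, y) = Dy v h (x, y).
Proof. by move=> fh; rewrite !Dy_line (funext fh). Qed.

Lemma Dy_cst v (c : R) p : Dy v (fun=> c) p = 0.
Proof. by rewrite DyE; exact: derive_cst. Qed.

(** Polarisation: the first derivative is the linear form given by [U], the second is constant. *)
Lemma quadratic_Dy3 (a b : 'I_n -> 'rV[R]_n) u v w p :
  Dy u (Dy v (Dy w (fun q => \sum_i dot q.2 (a i) * dot q.2 (b i)))) p = 0.
Proof.
pose U := \sum_i (dot w (b i) *: a i + dot w (a i) *: b i).
have oT : open [set: TM] := openT.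
have sd e : smooth_on [set: TM] (fun q => dot q.2 e) := smooth_dot_snd e oT.
have -> : Dy w (fun q => \sum_i dot q.2 (a i) * dot q.2 (b i)) = (fun q => dot q.2 U).
  apply/funext => q.
  rewrite (Dy_sumf oT _ w (fun i => smoothM oT (sd (a i)) (sd (b i))) I) /U.
  rewrite dotE; under [RHS]eq_bigr => j _ do rewrite summxE mulr_sumr.
  rewrite exchange_big/=; apply: eq_bigr => i _.
  rewrite (DyMf w (sd (a i)) (sd (b i)) I) !Dy_dot_snd !dotE !mulr_suml -big_split/=.
  by apply: eq_bigr => j _; rewrite !mxE -!dotE; ring.
have -> : Dy v (fun q => dot q.2 U) = (fun=> dot v U).
  by apply/funext => q; rewrite Dy_dot_snd.
by rewrite Dy_cst.
Qed.

End Fiber.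

(** * The Landsberg condition along arbitrary directions *)

Section LandsbergDirections.
Context {R : realType} {n : nat} (Omega : set 'rV[R]_n) (F : 'rV[R]_n * 'rV[R]_n -> R).
Context (oO : open Omega).
Context (rF : regular_Finsler Omega F).
Notation TM := ('rV[R]_n * 'rV[R]_n)%type.
Notation S := (sq F).
Notation G := (spray_vector F).
Local Notation e_ i := (delta_mx 0 i).
Implicit Types (u v w x y e : 'rV[R]_n) (p q : TM) (f h : TM -> R).

Let oS : open (slit Omega) := open_slit oO.
Let sS : smooth_on (slit Omega) S := smooth_sq oO rF.
Let sG i : smooth_on (slit Omega) (spray F i) := smooth_spray oO rF i.

Definition spray_dot e : TM -> R := fun q => dot (G q) e.

Lemma spray_dotE e q : spray_dot e q = \sum_i e 0 i * spray F i q.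
Proof. by rewrite /spray_dot dotE; apply: eq_bigr => i _; rewrite mxE mulrC. Qed.

Lemma smooth_spray_dot e : smooth_on (slit Omega) (spray_dot e).
Proof.
apply: eq_smooth oS _ _ _ (smooth_sum oS (index_enum 'I_n) xpredT
  (fun i => smoothZ oS (e 0 i) (sG i))) => q _.
by rewrite spray_dotE.
Qed.

Lemma Dy_lincomb v (c : 'I_n -> R) (f : 'I_n -> TM -> R) (h : TM -> R) p :
  (forall i, smooth_on (slit Omega) (f i)) ->
  (forall q, slit Omega q -> h q = \sum_i c i * f i q) -> slit Omega p ->
  Dy v h p = \sum_i c i * Dy v (f i) p.
Proof.
move=> sf hE Ap; rewrite (eq_Dy oS v hE Ap).
rewrite (Dy_sumf oS _ v (fun i => smoothZ oS (c i) (sf i)) Ap).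
by apply: eq_bigr => i _; rewrite (DyZf _ _ (sf i) Ap).
Qed.

Lemma Dy_spray_dot u e p : slit Omega p ->
  Dy u (spray_dot e) p = \sum_i e 0 i * Dy u (spray F i) p.
Proof. by apply: Dy_lincomb => // q _; exact: spray_dotE. Qed.

Lemma Dy3_spray_dot u v w e p : slit Omega p ->
  Dy u (Dy v (Dy w (spray_dot e))) p = \sum_i e 0 i * Dy u (Dy v (Dy w (spray F i))) p.
Proof.
have s1 i := smooth_Dy w (sG i); have s2 i := smooth_Dy v (s1 i).
apply: (Dy_lincomb u s2) => q Aq; apply: (Dy_lincomb v s1) => // q' Aq'.
exact: Dy_spray_dot.
Qed.

Lemma Dy3_sum u v w f p : smooth_on (slit Omega) f -> slit Omega p ->
  Dy u (Dy v (Dy w f)) p = \sum_j u 0 j * \sum_k v 0 k * \sum_l w 0 l *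
    Dy (e_ j) (Dy (e_ k) (Dy (e_ l) f)) p.
Proof.
move=> sf Ap; have sw := smooth_Dy w sf.
rewrite (Dy_sum oS u (smooth_Dy v sw) Ap); apply: eq_bigr => j _; congr (_ * _).
rewrite (Dy_frozen oO _ _ sw Ap); apply: eq_bigr => k _; congr (_ * _).
have sl l := smooth_Dy (e_ l) sf; have skl l := smooth_Dy (e_ k) (sl l).
apply: (Dy_lincomb (e_ j) skl) => // q Aq.
exact: (Dy_frozen oO).
Qed.

Lemma Dy_sq v p : slit Omega p -> Dy v S p = 2 * F p * Dy v F p.
Proof.
move=> Ap; have [sF _ _ _] := rF.
have <- : Dy v (fun q => F q * F q) p = Dy v S p by [].
by rewrite (DyMf v sF sF Ap); ring.
Qed.

(** Multilinearity extends the coordinate identity to all directions; as [Dy v S = 2 F Dy v F] with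
    [F > 0], the covector of [F] can be replaced by that of [S]. *)
Lemma Landsberg_Dy u v w p : Landsberg Omega F -> slit Omega p ->
  \sum_i Dy u (Dy v (Dy w (spray F i))) p * Dy (e_ i) S p = 0.
Proof.
move=> LF Ap; have [_ F0 _ _] := rF.
under eq_bigr => i _ do rewrite (Dy3_sum u v w (sG i) Ap) mulr_suml.
rewrite exchange_big/= big1// => j _.
under eq_bigr => i _ do rewrite -mulrA mulr_suml mulr_sumr.
rewrite exchange_big/= big1// => k _.
under eq_bigr => i _ do rewrite -mulrA mulr_suml !mulr_sumr.
rewrite exchange_big/= big1// => l _.
have := LF j k l p Ap; rewrite /Landsberg_curvature => /eqP.
rewrite mulf_eq0 mulf_eq0 oppr_eq0 invr_eq0 pnatr_eq0 (gt_eqF (F0 p Ap)) /= => /eqP L.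
transitivity (u 0 j * v 0 k * w 0 l * 2 * F p * \sum_i dy i F p *
   dy j (dy k (dy l (spray F i))) p); last by rewrite L mulr0.
rewrite mulr_sumr; apply: eq_bigr => i _.
by rewrite (Dy_sq _ Ap) !dyE; ring.
Qed.

Lemma spray_homogeneous x y (c : R) : Omega x -> y != 0 -> 0 < c ->
  G (x, c *: y) = c ^+ 2 *: G (x, y).
Proof.
move=> Ox y0 c0; have Ap : slit Omega (x, y) by [].
have Acp : slit Omega (x, c *: y) by split=> //=; rewrite scaler_eq0 negb_or gt_eqF.
apply/esym/(spray_char_unique oO rF Acp) => v /=.
have h2 := homogeneous_sq rF.
have h1 w : homogeneous Omega 1 (Dy w S) := homogeneous_Dy oO (k := 1) w h2 sS.
have h0 w : homogeneous Omega 0 (Dy v (Dy w S)).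
  exact: (homogeneous_Dy oO (k := 0) v (h1 w) (smooth_Dy w sS)).
have hx w : homogeneous Omega 2 (Dx w S) := homogeneous_Dx oO w h2 sS.
have hyx w : homogeneous Omega 1 (Dy v (Dx w S)).
  exact: (homogeneous_Dy oO (k := 1) v (hx w) (smooth_Dx w sS)).
have E := spray_char oO rF v Ap.
rewrite (h0 _ _ _ _ Ox y0 c0) (hyx _ _ _ _ Ox y0 c0) (hx _ _ _ _ Ox y0 c0).
rewrite expr0 mul1r expr1.
have -> : Dy v (Dy (c ^+ 2 *: G (x, y)) S) (x, y) = c ^+ 2 * Dy v (Dy (G (x, y)) S) (x, y).
  rewrite !(Dy_frozen oO v _ sS Ap) mulr_sumr.
  by apply: eq_bigr => i _; rewrite mxE mulrA.
have -> : Dy v (Dx (c *: y) S) (x, y) = c * Dy v (Dx y S) (x, y).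
  rewrite !(Dy_frozenx oO v _ sS Ap) mulr_sumr.
  by apply: eq_bigr => i _; rewrite mxE mulrA.
by rewrite mulrCA E /=; ring.
Qed.

End LandsbergDirections.

(** * Restriction to a plane through the radial direction *)

Section Plane.
Context {R : realType} {n : nat} (Omega : set 'rV[R]_n) (F : 'rV[R]_n * 'rV[R]_n -> R).
Context (n3 : (3 <= n)%N).
Context (oO : open Omega).
Context (rF : regular_Finsler Omega F).
Context (sF : spherically_symmetric Omega F).
Context (LF : Landsberg Omega F).
Notation TM := ('rV[R]_n * 'rV[R]_n)%type.
Notation S := (sq F).
Notation G := (spray_vector F).
Notation Gd := (spray_dot F).
Local Notation e_ i := (delta_mx 0 i).
Implicit Types (u v w y : 'rV[R]_n) (p q : TM) (f h : TM -> R).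

Let oS : open (slit Omega) := open_slit oO.
Let sS : smooth_on (slit Omega) S := smooth_sq oO rF.
Let sGd e : smooth_on (slit Omega) (Gd e) := smooth_spray_dot oO rF e.

Context (x e1 : 'rV[R]_n) (rho : R).
Context (Ox : Omega x).
Context (e11 : dot e1 e1 = 1).
Context (rho0 : rho != 0).
Context (xE : x = rho *: e1).

Lemma spray_in_plane y v : y != 0 -> dot e1 v = 0 -> dot y v = 0 -> dot (G (x, y)) v = 0.
Proof.
move=> y0 v1 vy; apply: (spray_perp n3 oO rF sF) => //=.
by rewrite xE dotZl v1 mulr0.
Qed.

Lemma Dy_in_plane y v : y != 0 -> dot e1 v = 0 -> dot y v = 0 -> Dy v S (x, y) = 0.
Proof.
move=> y0 v1 vy; apply: (sq_perp n3 oO rF sF) => //=.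
by rewrite xE dotZl v1 mulr0.
Qed.

Context (e2 e3 : 'rV[R]_n).
Context (e22 : dot e2 e2 = 1).
Context (e33 : dot e3 e3 = 1).
Context (e12 : dot e1 e2 = 0).
Context (e13 : dot e1 e3 = 0).
Context (e23 : dot e2 e3 = 0).

Let e21 : dot e2 e1 = 0. Proof. by rewrite dotC. Qed.
Let e31 : dot e3 e1 = 0. Proof. by rewrite dotC. Qed.
Let e32 : dot e3 e2 = 0. Proof. by rewrite dotC. Qed.
Let frame := (e11, e22, e33, e12, e13, e23, e21, e31, e32).

(** The component [W] of [V] normal to the plane is killed by the reflection argument. *)
Lemma covector_plane (a b : R) V : a *: e1 + b *: e2 != 0 ->
  Dy V S (x, a *: e1 + b *: e2) =
  dot V e1 * Dy e1 S (x, a *: e1 + b *: e2) + dot V e2 * Dy e2 S (x, a *: e1 + b *: e2).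
Proof.
set y := _ + _ => y0; have Ap : slit Omega (x, y) by [].
pose W := V - dot V e1 *: e1 - dot V e2 *: e2.
have W0 : Dy W S (x, y) = 0.
  apply: Dy_in_plane => //; first by rewrite dotC !dot_lin !frame; ring.
  by rewrite dotC /y !dot_lin !frame; ring.
have -> : V = W + (dot V e1 *: e1 + dot V e2 *: e2).
  by rewrite /W [X in _ + X]addrC addrA !subrK.
rewrite (DyD oS _ _ sS Ap) W0 add0r (DyD oS _ _ sS Ap) !(DyZ oS _ _ sS Ap).
rewrite -/W; congr (_ * _ + _ * _); by rewrite /W !dot_lin !frame; ring.
Qed.

(** Infinitesimal invariance under the rotations of the plane of [e2] and [e3], which fix [x]. *)
Lemma sq_rotation y : y != 0 -> dot y e2 * Dy e3 S (x, y) = dot y e3 * Dy e2 S (x, y).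
Proof.
move=> y0; have Ap : slit Omega (x, y) by [].
have := sq_turn n3 oO rF sF e22 e33 e23 Ap; rewrite /turn /= xE !dotZl e12 e13.
rewrite !mulr0 !scale0r subr0 -scaleN1r -xE.
have -> : Dx 0 S (x, y) = 0 by rewrite DxE; exact: derive0.
rewrite (DyD oS _ _ sS Ap) !(DyZ oS _ _ sS Ap) add0r mulN1r => /eqP.
by rewrite subr_eq0 => /eqP.
Qed.

Lemma spray_rotation e y : y != 0 ->
  dot y e2 * Dy e3 (Gd e) (x, y) - dot y e3 * Dy e2 (Gd e) (x, y) =
  Gd e2 (x, y) * dot e3 e - Gd e3 (x, y) * dot e2 e.
Proof.
move=> y0; have Ap : slit Omega (x, y) by [].
have x2 : dot (x, y).1 e2 = 0 by rewrite /= xE dotZl e12 mulr0.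
have x3 : dot (x, y).1 e3 = 0 by rewrite /= xE dotZl e13 mulr0.
have := spray_turn n3 oO rF sF e e22 e33 e23 x2 x3 Ap.
rewrite -[fun q => _]/(Gd e) /turn /= -scaleN1r.
rewrite (DyD oS _ _ (sGd e) Ap) !(DyZ oS _ _ (sGd e) Ap) !dot_lin mulN1r => ->.
by rewrite /spray_dot; ring.
Qed.

(** Differentiate the rotation identity along [e3] where the [e3] coordinate vanishes: the mixed
    second derivative drops out. *)
Lemma Dy_rotation f h y : smooth_on (slit Omega) f -> smooth_on (slit Omega) h ->
  (forall z, z != 0 -> dot z e2 * Dy e3 f (x, z) - dot z e3 * Dy e2 f (x, z) = h (x, z)) ->
  y != 0 -> dot y e3 = 0 ->
  dot y e2 * Dy e3 (Dy e3 f) (x, y) - Dy e2 f (x, y) = Dy e3 h (x, y).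
Proof.
move=> sf sh fh y0 y3; have Ap : slit Omega (x, y) by [].
have oY : open [set z : 'rV[R]_n | z != 0].
  rewrite (_ : [set z | _] = ~` [set (0 : 'rV[R]_n)]).
    apply: closed_openC; apply: accessible_closed_set1; exact: hausdorff_accessible.
  by apply/seteqP; split=> z /= /eqP.
rewrite -(eq_Dy_fiber e3 (f := fun q => dot q.2 e2 * Dy e3 f q - dot q.2 e3 * Dy e2 f q)
  (h := h) oY fh y0).
have s2 := smooth_dot_snd e2 oS; have s3 := smooth_dot_snd e3 oS.
have f2 := smooth_Dy e2 sf; have f3 := smooth_Dy e3 sf.
rewrite (DyBf e3 (smoothM oS s2 f3) (smoothM oS s3 f2) Ap).
rewrite (DyMf e3 s2 f3 Ap) (DyMf e3 s3 f2 Ap) !Dy_dot_snd /= y3 !frame; ring.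
Qed.

Context (a : R).
Implicit Type b : R.
Context (a0 : a != 0).
Let line (b : R) : TM := (x, a *: e1 + b *: e2).

Lemma line_neq0 b : a *: e1 + b *: e2 != 0.
Proof.
apply: contra_neq a0 => E; have := congr1 (dot^~ e1) E.
by rewrite /= dot0l !dot_lin !frame => <-; ring.
Qed.

Lemma slit_line b : slit Omega (line b).
Proof. by split=> //; exact: line_neq0. Qed.

Lemma is_derive_line_plane f b : smooth_on (slit Omega) f ->
  is_derive b 1 (fun t => f (line t)) (Dy e2 f (line b)).
Proof. by move=> sf; apply: (is_derive_vertical sf); exact: slit_line. Qed.

Lemma dot_line1 b : dot (a *: e1 + b *: e2) e1 = a.
Proof. by rewrite !dot_lin !frame; ring. Qed.

Lemma dot_line2 b : dot (a *: e1 + b *: e2) e2 = b.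
Proof. by rewrite !dot_lin !frame; ring. Qed.

Lemma dot_line3 b : dot (a *: e1 + b *: e2) e3 = 0.
Proof. by rewrite !dot_lin !frame; ring. Qed.

Lemma Euler_plane k f b : homogeneous Omega k f -> smooth_on (slit Omega) f ->
  a * Dy e1 f (line b) + b * Dy e2 f (line b) = k%:R * f (line b).
Proof.
move=> hf sf; have Ap := slit_line b.
rewrite -(Euler hf sf Ap) (DyD oS _ _ sf Ap) !(DyZ oS _ _ sf Ap) //.
Qed.

(** With convexity of [S] this shows that the derivative along [e2] is nonzero for [b > 0]. *)
Lemma sq_e2 b : Dy e2 S (line b) = b * Dy e3 (Dy e3 S) (line b).
Proof.
have H z : z != 0 -> dot z e2 * Dy e3 S (x, z) - dot z e3 * Dy e2 S (x, z) = cst 0 (x, z).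
  by move=> z0; rewrite sq_rotation// subrr.
have := Dy_rotation sS (smooth_cst oS 0) H (line_neq0 b) (dot_line3 b).
by rewrite dot_line2 Dy_cst => /eqP; rewrite subr_eq0 => /eqP <-.
Qed.

Lemma Gd1_second b : b * Dy e3 (Dy e3 (Gd e1)) (line b) = Dy e2 (Gd e1) (line b).
Proof.
have H z : z != 0 -> dot z e2 * Dy e3 (Gd e1) (x, z) - dot z e3 * Dy e2 (Gd e1) (x, z) =
    cst 0 (x, z).
  by move=> z0; rewrite spray_rotation// !frame !mulr0 subrr.
have := Dy_rotation (sGd e1) (smooth_cst oS 0) H (line_neq0 b) (dot_line3 b).
by rewrite dot_line2 Dy_cst => /eqP; rewrite subr_eq0 => /eqP.
Qed.

Lemma Gd2_second b : b ^+ 2 * Dy e3 (Dy e3 (Gd e2)) (line b) =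
  b * Dy e2 (Gd e2) (line b) - Gd e2 (line b).
Proof.
have H z : z != 0 -> dot z e2 * Dy e3 (Gd e2) (x, z) - dot z e3 * Dy e2 (Gd e2) (x, z) =
    -1 * Gd e3 (x, z).
  by move=> z0; rewrite spray_rotation// !frame mulr0 mulr1 sub0r mulN1r.
have := Dy_rotation (sGd e2) (smoothZ oS (-1) (sGd e3)) H (line_neq0 b) (dot_line3 b).
rewrite dot_line2 (DyZf _ _ (sGd e3) (slit_line b)) -/(line b) => E1.
(* The derivative of G3 left over comes from the rotation identity for [e3] itself: on the line, [b]
   times D3 G3 is G2. *)
have := spray_rotation e3 (line_neq0 b).
rewrite dot_line2 dot_line3 -/(line b) !frame mul0r mulr0 !subr0 mulr1 => E2.
rewrite -E2 expr2 -mulrA -mulrBr; congr (_ * _).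
by move/eqP: E1; rewrite subr_eq => /eqP ->; rewrite mulN1r addrC.
Qed.

(** For [b = 0] the points stay in the plane of [e1] and [e3], where the reflection along [e2]
    forces G2 to vanish identically. *)
Lemma Gd2_second0 : Dy e3 (Dy e3 (Gd e2)) (line 0) = 0.
Proof.
have ae t : a *: e1 + 0 *: e2 + t *: e3 != 0.
  apply: contra_neq a0 => E; have := congr1 (dot^~ e1) E.
  by rewrite /= dot0l !dot_lin !frame => <-; ring.
have Z t : Gd e2 (x, a *: e1 + 0 *: e2 + t *: e3) = 0.
  apply: spray_in_plane => //; by rewrite !dot_lin !frame; ring.
rewrite -[RHS](Dy_cst e3 0 (line 0)); apply: eq_Dy_line => t.
rewrite -[RHS](Dy_cst e3 0 (x, a *: e1 + 0 *: e2 + t *: e3)).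
by apply: eq_Dy_line => s; rewrite -addrA -scalerDl Z.
Qed.

(** [horizontal_sq] expresses the horizontal derivative of [S] along [e2]; the rotation in the plane
    of [e1] and [e2] moves [x] by [rho e2] and [y] by [a e2 - b e1], which gives a second expression
    for it. *)
Lemma horizontal_plane b :
  Dy e1 S (line b) * (Dy e2 (Gd e1) (line b) - b * rho^-1) +
  Dy e2 S (line b) * (Dy e2 (Gd e2) (line b) + a * rho^-1) = 0.
Proof.
have Ap := slit_line b.
have := horizontal_sq oO rF e2 Ap.
pose V : 'rV[R]_n := \row_i Dy e2 (spray F i) (line b).
have -> : \sum_i Dy e2 (spray F i) (line b) * Dy (e_ i) S (line b) = Dy V S (line b).
  by rewrite (Dy_sum oS V sS Ap); apply: eq_bigr => i _; rewrite mxE.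
have VE e : dot V e = Dy e2 (Gd e) (line b).
  by rewrite (Dy_spray_dot oO rF e2 e Ap) dotE; apply: eq_bigr => i _; rewrite mxE mulrC.
rewrite (covector_plane V (line_neq0 b)) !VE => E.
have := sq_turn n3 oO rF sF e11 e22 e12 Ap.
rewrite /turn /= dot_line1 dot_line2 xE !dotZl e11 e12 mulr1 mulr0 scale0r subr0.
rewrite -scaleNr (DyD oS _ _ sS Ap) !(DyZ oS _ _ sS Ap) (DxZ oS _ _ sS Ap) -E.
rewrite -/(line b) => T; apply: (mulfI rho0); rewrite mulr0 -[RHS]T.
by field.
Qed.

Lemma Landsberg_plane u v w b :
  Dy e1 S (line b) * Dy u (Dy v (Dy w (Gd e1))) (line b) +
  Dy e2 S (line b) * Dy u (Dy v (Dy w (Gd e2))) (line b) = 0.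
Proof.
have Ap := slit_line b; have := Landsberg_Dy oO rF u v w LF Ap.
pose V : 'rV[R]_n := \row_i Dy u (Dy v (Dy w (spray F i))) (line b).
have -> : \sum_i Dy u (Dy v (Dy w (spray F i))) (line b) * Dy (e_ i) S (line b) =
    Dy V S (line b).
  by rewrite (Dy_sum oS V sS Ap); apply: eq_bigr => i _; rewrite mxE.
have VE e : dot V e = Dy u (Dy v (Dy w (Gd e))) (line b).
  rewrite (Dy3_spray_dot oO rF u v w e Ap) dotE.
  by apply: eq_bigr => i _; rewrite mxE mulrC.
by rewrite (covector_plane V (line_neq0 b)) !VE => <-; rewrite -/(line b); ring.
Qed.

Lemma continuous_line f : smooth_on (slit Omega) f ->
  {for 0, continuous (fun t : R => f (line t))}.
Proof.
move=> sf; have [D _] := is_derive_line_plane 0 sf.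
exact/differentiable_continuous/derivable1_diffP.
Qed.

Lemma spray_line : exists c m, forall b, 0 < b ->
  Gd e1 (line b) = Gd e1 (line 0) + c * b ^+ 2 /\ Gd e2 (line b) = m * b.
Proof.
have h1 : homogeneous Omega 1 (Dy e1 S).
  exact: (homogeneous_Dy oO (k := 1) e1 (homogeneous_sq rF) sS).
have s1 := smooth_Dy e1 sS; have s2 := smooth_Dy e2 sS.
pose X1 := Dy e3 (Dy e3 (Gd e1)); pose X2 := Dy e3 (Dy e3 (Gd e2)).
have sX1 : smooth_on (slit Omega) X1 := smooth_Dy e3 (smooth_Dy e3 (sGd e1)).
have sX2 : smooth_on (slit Omega) X2 := smooth_Dy e3 (smooth_Dy e3 (sGd e2)).
have sD e := smooth_Dy e2 (sGd e); have sDD e := smooth_Dy e2 (sD e).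
apply: (@plane_ode R a rho^-1 (fun b => Dy e1 S (line b)) (fun b => Dy e2 S (line b))
  (fun b => Dy e2 (Dy e1 S) (line b)) (fun b => Dy e2 (Dy e2 S) (line b))
  (fun b => Gd e1 (line b)) (fun b => Dy e2 (Gd e1) (line b))
  (fun b => Dy e2 (Dy e2 (Gd e1)) (line b)) (fun b => Dy e2 (Dy e2 (Dy e2 (Gd e1))) (line b))
  (fun b => Gd e2 (line b)) (fun b => Dy e2 (Gd e2) (line b))
  (fun b => Dy e2 (Dy e2 (Gd e2)) (line b)) (fun b => Dy e2 (Dy e2 (Dy e2 (Gd e2))) (line b))
  (fun b => X2 (line b))).
- move=> b b0; split; [exact: (is_derive_line_plane b s1)|exact: (is_derive_line_plane b s2)| | |].
  + rewrite sq_e2 mulf_neq0// ?gt_eqF//; apply: (Dy2_gt0 oO rF (slit_line b)).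
    by apply: contra_eq_neq e33 => ->; rewrite dot0l eq_sym oner_eq0.
  + rewrite (Euler_plane b (homogeneous_sq rF) sS) mulf_neq0// ?pnatr_eq0// gt_eqF//.
    exact: (sq_gt0 rF (slit_line b)).
  (* Differentiate Euler's relation [a S1 + b S2 = 2 S] in [b]. *)
  + have D : is_derive b 1 (fun t => a * Dy e1 S (line t) + t * Dy e2 S (line t))
        (a * Dy e2 (Dy e1 S) (line b) + b * Dy e2 (Dy e2 S) (line b) + Dy e2 S (line b)).
      have d1 := is_derive_line_plane b s1; have d2 := is_derive_line_plane b s2.
      apply: has_derivative_eq.
        apply: has_derivativeD; first exact: (has_derivativeM (has_derivative_cst b a) d1).
        exact: (has_derivativeM (has_derivative_id b) d2).
      by rewrite /=; ring.
    have D' : is_derive b 1 (fun t => 2 * S (line t)) (2 * Dy e2 S (line b)).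
      have d := is_derive_line_plane b sS.
      apply: has_derivative_eq; first exact: (has_derivativeM (has_derivative_cst b 2) d).
      by rewrite /=; ring.
    have := eq_is_derive_pos (fun t _ => Euler_plane t (homogeneous_sq rF) sS) b0 D D'.
    by rewrite mulr_natl mulr2n => /addIr.
(* S1 has degree 1, so where it vanishes Euler gives [a] D1 S1 + [b] D2 S1 = 0, and D1 S1 is
   positive. *)
- move=> b b0 s10; have := Euler_plane b h1 s1; rewrite s10 mulr0 => /eqP.
  rewrite addr_eq0 => /eqP E; apply: contra_eq_neq E => ->.
  rewrite mulr0 oppr0 mulf_neq0// gt_eqF//; apply: (Dy2_gt0 oO rF (slit_line b)).
  by apply: contra_eq_neq e11 => ->; rewrite dot0l eq_sym oner_eq0.
- by move=> b b0; split; [exact: (is_derive_line_plane b (sGd e1))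
    |exact: (is_derive_line_plane b (sD e1))|exact: (is_derive_line_plane b (sDD e1))].
- by move=> b b0; split; [exact: (is_derive_line_plane b (sGd e2))
    |exact: (is_derive_line_plane b (sD e2))|exact: (is_derive_line_plane b (sDD e2))].
- by move=> b b0; exact: horizontal_plane.
(* The (2,3,3) component. Differentiating the formulas for D3 D3 G1 and D3 D3 G2 along the line
   expresses their derivatives through those of G1 and G2; [b^3] clears denominators. *)
- move=> b b0; have L := Landsberg_plane e2 e3 e3 b.
  have d1 := is_derive_line_plane b sX1; have d2 := is_derive_line_plane b sX2.
  have dA := is_derive_line_plane b (sD e1).
  have dK := is_derive_line_plane b (sGd e2); have dK1 := is_derive_line_plane b (sD e2).
  have E1 : b * Dy e2 X1 (line b) + X1 (line b) = Dy e2 (Dy e2 (Gd e1)) (line b).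
    apply: (eq_is_derive_pos (fun t _ => Gd1_second t) b0) => //.
    apply: has_derivative_eq; first exact: (has_derivativeM (has_derivative_id b) d1).
    by rewrite /=; ring.
  have E2 : b ^+ 2 * Dy e2 X2 (line b) + 2 * b * X2 (line b) =
      b * Dy e2 (Dy e2 (Gd e2)) (line b).
    apply: (eq_is_derive_pos (fun t _ => Gd2_second t) b0).
      apply: has_derivative_eq.
        exact: (has_derivativeM (has_derivativeM (has_derivative_id b) (has_derivative_id b)) d2).
      by rewrite /=; ring.
    apply: has_derivative_eq.
      exact: (has_derivativeB (has_derivativeM (has_derivative_id b) dK1) dK).
    by rewrite /=; ring.
  have M : b ^+ 2 * Dy e2 (Dy e2 (Gd e1)) (line b) - b * Dy e2 (Gd e1) (line b) =
      b ^+ 3 * Dy e2 X1 (line b).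
    by rewrite -E1 -Gd1_second -/X1; ring.
  have N : b ^+ 2 * Dy e2 (Dy e2 (Gd e2)) (line b) - 2 * b * Dy e2 (Gd e2) (line b) +
      2 * Gd e2 (line b) = b ^+ 3 * Dy e2 X2 (line b).
    transitivity (b * (b * Dy e2 (Dy e2 (Gd e2)) (line b)) -
      2 * (b * Dy e2 (Gd e2) (line b) - Gd e2 (line b))); first by ring.
    by rewrite -E2 -Gd2_second -/X2; ring.
  rewrite M N; transitivity (b ^+ 3 * (Dy e1 S (line b) * Dy e2 X1 (line b) +
    Dy e2 S (line b) * Dy e2 X2 (line b))); first by ring.
  by rewrite L mulr0.
- by move=> b b0; exact: Landsberg_plane.
- exact: (continuous_line (sGd e1)).
- exact: (continuous_line sX2).
- exact: Gd2_second0.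
- by move=> b b0; exact: Gd2_second.
Qed.

End Plane.

(** * Berwald curvature *)

Section Berwald.
Context {R : realType} {n : nat} (Omega : set 'rV[R]_n) (F : 'rV[R]_n * 'rV[R]_n -> R).
Context (n3 : (3 <= n)%N).
Context (oO : open Omega).
Context (rF : regular_Finsler Omega F).
Context (sF : spherically_symmetric Omega F).
Context (LF : Landsberg Omega F).
Notation TM := ('rV[R]_n * 'rV[R]_n)%type.
Notation S := (sq F).
Notation G := (spray_vector F).
Notation Gd := (spray_dot F).
Local Notation e_ i := (delta_mx 0 i).
Implicit Types (u v w x y : 'rV[R]_n) (p q : TM) (f h : TM -> R).

Let oS : open (slit Omega) := open_slit oO.

(** The reflection along [u - v] exchanges the two unit vectors and fixes everything orthogonal to
    both. *)
Lemma isometry_unit e1 u v : dot u u = 1 -> dot v v = 1 -> dot e1 u = 0 -> dot e1 v = 0 ->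
  exists T, [/\ orthogonal_mx T, e1 *m T = e1 & u *m T = v].
Proof.
move=> u1 v1 eu ev; have [->|uv] := eqVneq u v.
  by exists 1%:M; split; rewrite ?mulmx1// /orthogonal_mx trmx1 mulmx1.
rewrite -subr_eq0 in uv; have [w w1 [c c0 wE]] := unit_scale uv.
have cn0 : c != 0 by rewrite gt_eqF.
exists (reflection w); split; first exact: reflection_orthogonal.
  apply: reflection_fix; apply: (mulfI cn0).
  by rewrite mulr0 -dotZr -wE !dot_lin eu ev subrr.
have cc : c * (2 * dot u w) = c * c.
  have <- : dot (u - v) (u - v) = c * c by rewrite wE !dot_lin w1 mulr1.
  by rewrite mulrCA -dotZr -wE !dot_lin u1 v1 (dotC v u); ring.
by rewrite mul_reflection (mulfI cn0 cc) -wE opprB addrC subrK.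
Qed.

(** * The spray over one base point, on a half-space of directions *)

Section FixedPoint.
Context (x e1 : 'rV[R]_n) (rho : R).
Context (Ox : Omega x).
Context (e11 : dot e1 e1 = 1).
Context (rho0 : rho != 0).
Context (xE : x = rho *: e1).

Lemma spray_decomposition e2 (a b : R) : dot e2 e2 = 1 -> dot e1 e2 = 0 ->
  a *: e1 + b *: e2 != 0 ->
  G (x, a *: e1 + b *: e2) =
  Gd e1 (x, a *: e1 + b *: e2) *: e1 + Gd e2 (x, a *: e1 + b *: e2) *: e2.
Proof.
move=> e22 e12 y0; have e21 : dot e2 e1 = 0 by rewrite dotC.
rewrite /spray_dot; set g := G _.
pose W := g - (dot g e1 *: e1 + dot g e2 *: e2).
have W1 : dot W e1 = 0 by rewrite /W !dot_lin e11 e21; ring.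
have W2 : dot W e2 = 0 by rewrite /W !dot_lin e22 e12; ring.
have gW : dot g W = 0.
  apply: (spray_in_plane n3 oO rF sF Ox xE y0); first by rewrite dotC.
  by rewrite dotDl !dotZl !(dotC _ W) W1 W2; ring.
have : dot W W = 0.
  by rewrite {1}/W dotDl gW dotNl dotDl !dotZl !(dotC _ W) W1 W2; ring.
by move=> /dot_eq0/eqP; rewrite subr_eq0 => /eqP.
Qed.

(** Homogeneity reduces to radial component 1, and an isometry fixing [x] brings the part of [y]
    orthogonal to [e1] onto the ray of [e2]; there [spray_line] with [a = 1] applies. *)
Lemma spray_quadratic : exists k c m, forall y, 0 < dot y e1 ->
  G (x, y) = (k * dot y e1 ^+ 2 + c * (dot y y - dot y e1 ^+ 2)) *: e1 +
    (m * dot y e1) *: (y - dot y e1 *: e1).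
Proof.
have [e2 [e22 e21 _]] := unit_orthogonal e1 e1 n3.
have [e3 [e33 e31 e32]] := unit_orthogonal e1 e2 n3.
have e12 : dot e1 e2 = 0 by rewrite dotC.
have e13 : dot e1 e3 = 0 by rewrite dotC.
have e23 : dot e2 e3 = 0 by rewrite dotC.
have [c [m cm]] := spray_line n3 oO rF sF LF Ox e11 rho0 xE e22 e33 e12 e13 e23 (oner_neq0 R).
have line0 (b : R) : 1 *: e1 + b *: e2 != 0 by exact: (line_neq0 e11 e12 (oner_neq0 R) b).
rewrite /= in cm; set k := Gd e1 (x, 1 *: e1 + 0 *: e2) in cm.
exists k, c, m => y a0; set a := dot y e1 in a0 *.
have an0 : a != 0 by rewrite gt_eqF.
have scale z : z != 0 -> y = a *: z -> G (x, y) = a ^+ 2 *: G (x, z).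
  by move=> z0 yz; rewrite {1}yz; exact: (spray_homogeneous oO rF Ox z0 a0).
have yE : y = a *: e1 + (y - a *: e1) by rewrite addrC subrK.
have yy : dot y y - a ^+ 2 = dot (y - a *: e1) (y - a *: e1).
  by rewrite !dot_lin e11 (dotC e1) -/a; ring.
(* Radial [y] is treated apart, since [spray_line] covers [b > 0] only. *)
rewrite yy; have [w0|w0] := eqVneq (y - a *: e1) 0.
  rewrite w0 scaler0 dot0l mulr0 !addr0.
  rewrite (scale (1 *: e1 + 0 *: e2))//; last first.
    by rewrite {1}yE w0 addr0 scale0r addr0 scale1r.
  rewrite (spray_decomposition e22 e12 (line0 0)) -/k.
  have -> : Gd e2 (x, 1 *: e1 + 0 *: e2) = 0.
    by apply: (spray_in_plane n3 oO rF sF Ox xE) => //; rewrite !dot_lin e12; ring.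
  by rewrite scale0r addr0 scalerA mulrC.
have [w w1 [b b0 wE]] := unit_scale w0.
have ew : dot e1 w = 0.
  apply: (mulfI (lt0r_neq0 b0)); rewrite mulr0 -dotZr -wE !dot_lin e11 (dotC e1) -/a.
  by ring.
have [T [oT eT uT]] := isometry_unit e22 w1 e12 ew.
have xT : x *m T = x by rewrite xE -scalemxAl eT.
rewrite (scale ((1 *: e1 + (b / a) *: e2) *m T)); last 2 first.
- by rewrite mulmx_orthogonal_eq0.
- rewrite mulmxDl -!scalemxAl eT uT scalerDr !scalerA mulr1 mulrC divfK//.
  by rewrite -wE.
have Ap : slit Omega (x, 1 *: e1 + (b / a) *: e2) by split=> //; exact: line0.
have := spray_act n3 oO rF sF oT Ap; rewrite /act /= xT => /(_ Ox) ->.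
rewrite (spray_decomposition e22 e12 (line0 _)).
have [-> ->] := cm (b / a) (divr_gt0 b0 a0).
rewrite mulmxDl -!scalemxAl eT uT wE !dot_lin w1 scalerDr !scalerA.
by congr (_ *: _ + _ *: _); field.
Qed.

Lemma Berwald_fiber u v w y i : 0 < dot y e1 -> Dy u (Dy v (Dy w (spray F i))) (x, y) = 0.
Proof.
move=> y1; have [k [c [m Gq]]] := spray_quadratic.
have oY : open [set z : 'rV[R]_n | 0 < dot z e1].
  apply: (open_comp (f := fun z => dot z e1) (D := [set r : R | 0 < r])).
    by move=> z _; exact: continuous_dotr.
  exact: open_gt.
(* The terms of [spray_quadratic] regrouped by the factor [dot z (e_ j)], to match the shape in
   [quadratic_Dy3]. *)
pose V j := e1 0 j *: (((k - c - m) * e1 0 i) *: e1 + m *: e_ i) + (c * e1 0 i) *: e_ j.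
have E z : 0 < dot z e1 -> spray F i (x, z) = \sum_j dot z (e_ j) * dot z (V j).
  move=> z1; have := congr1 (fun g : 'rV[R]_n => g 0 i) (Gq z z1); rewrite !mxE => ->.
  rewrite [RHS](eq_bigr (fun j => ((k - c - m) * e1 0 i * dot z e1 + m * z 0 i) *
     (z 0 j * e1 0 j) + c * e1 0 i * (z 0 j * z 0 j))).
    by rewrite big_split/= -!mulr_sumr -(dotE z z) -(dotE z e1); ring.
  by move=> j _; rewrite /V !dot_lin !dot_delta; ring.
rewrite -[RHS](quadratic_Dy3 (fun j => e_ j) V u v w (x, y)).
apply: (eq_Dy_fiber u oY _ y1) => z1 Y1; apply: (eq_Dy_fiber v oY _ Y1) => z2 Y2.
by apply: (eq_Dy_fiber w oY _ Y2) => z3 Y3; exact: E.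
Qed.

End FixedPoint.

Lemma Berwald_nonorthogonal u v w x y i : slit Omega (x, y) -> dot x y != 0 ->
  Dy u (Dy v (Dy w (spray F i))) (x, y) = 0.
Proof.
move=> [/= Ox y0] xy.
have x0 : x != 0 by apply: contra_neq xy => ->; rewrite dot0l.
have s0 : 0 < Num.sqrt (dot x x) by rewrite sqrtr_gt0 dot_gt0.
(* The sign puts [y] in the half-space where its product with [x / rho] is positive; [rho] may thus
   be negative. *)
pose rho := Num.sg (dot x y) * Num.sqrt (dot x x).
have rho0 : rho != 0 by rewrite mulf_neq0 ?sgr_eq0// gt_eqF.
have rho2 : rho ^+ 2 = dot x x.
  by rewrite exprMn sqr_sg xy mul1r sqr_sqrtr// ltW// dot_gt0.
apply: (@Berwald_fiber x (rho^-1 *: x) rho) => //.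
- by rewrite !dot_lin mulrA -rho2 -invfM -expr2 mulVf// expf_neq0.
- by rewrite scalerA mulfV// scale1r.
rewrite dotZr (dotC y) /rho invfM mulrAC mulr_gt0 ?invr_gt0//.
case: (ltrgt0P (dot x y)) xy => [d0 _|d0 _|//].
  by rewrite gtr0_sg// invr1 mul1r.
by rewrite ltr0_sg// invrN1 mulN1r oppr_gt0.
Qed.

Lemma Berwald_slit u v w p i : slit Omega p -> Dy u (Dy v (Dy w (spray F i))) p = 0.
Proof.
case: p => x y Ap; have [xy|xy] := eqVneq (dot x y) 0; last exact: Berwald_nonorthogonal.
have [/= Ox y0] := Ap; set f := Dy u _.
have sf : smooth_on (slit Omega) f.
  exact: (smooth_Dy u (smooth_Dy v (smooth_Dy w (smooth_spray oO rF i)))).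
(* The points [(x + t *: y, y)] with [t != 0] are covered by the previous lemma. *)
have cl : {for 0, continuous (fun t : R => (x + t *: y, y) : TM)}.
  have cx : (fun t : R => x + t *: y) @ nbhs (0 : R) --> x + 0 *: y.
    by apply: cvgD; [exact: cvg_cst|apply: (cvgZr_tmp (s := id)); exact: cvg_id].
  exact: (cvg_pair cx (cvg_cst y)).
have cf : {for 0, continuous (fun t : R => f (x + t *: y, y))}.
  apply: (continuous_comp (f := fun t : R => (x + t *: y, y) : TM) (g := f)) => //.
  by rewrite scale0r addr0; exact: smooth_continuous sf Ap.
have ns : nbhs (0 : R) (fun t => slit Omega (x + t *: y, y)).
  have nS : nbhs ((x + 0 *: y, y) : TM) (slit Omega).
    by apply: open_nbhs_nbhs; split=> //; rewrite scale0r addr0.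
  exact: (cl _ nS).
have E : f (x, y) = f (x + 0 *: y, y) by rewrite scale0r addr0.
have c0 : (fun t : R => f (x + t *: y, y)) @ (0 : R)^' --> f (x + 0 *: y, y).
  exact/continuous_withinNx.
have f0 : \forall t \near (0 : R)^', f (x + t *: y, y) = 0.
  near=> t; have At : slit Omega (x + t *: y, y) by near: t; exact: nbhs_dnbhs.
  have t0 : t != 0 by near: t; exact: nbhs_dnbhs_neq.
  apply: (Berwald_nonorthogonal _ _ _ _ At).
  by rewrite !dot_lin xy add0r mulf_neq0// gt_eqF// dot_gt0.
by rewrite E -(cvg_lim _ c0)// (lim_near_cst _ f0).
Unshelve. all: by end_near. Qed.

End Berwald.

Theorem corollary4p3 (R : realType) (n : nat) (Omega : set 'rV[R]_n)
    (F : 'rV[R]_n * 'rV[R]_n -> R) :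
  (3 <= n)%N ->
  domain Omega ->
  regular_Finsler Omega F ->
  spherically_symmetric Omega F ->
  Landsberg Omega F ->
  Berwaldian Omega F.
Proof.
move=> n3 [_ oO _] rF sF LF i j k l p Ap.
by rewrite /Berwald_curvature !dyE; exact: (Berwald_slit n3 oO rF sF LF).
Qed.
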